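(* Let $n\in\mathbb N$ and let $T:\mathbb R_n[z]\to\mathbb R[z]$ be a linear operator. Then $T$ preserves hyperbolicity (i.e. $T(f)$ is hyperbolic or $0$ for every hyperbolic $f\in\mathbb R_n[z]$) if and only if one of the following holds: (a) $T$ has range of dimension at most two and is of the form $T(f)=\alpha(f)P+\beta(f)Q$ for $f\in\mathbb R_n[z]$, where $\alpha,\beta:\mathbb R_n[z]\to\mathbb R$ are linear functionals and $P,Q$ are hyperbolic polynomials whose zeros interlace; (b) $T[(z+w)^n]\in\mathcal H_2(\mathbb R)$; (c) $T[(z-w)^n]\in\mathcal H_2(\mathbb R)$.
   Context: $\mathbb R_n[z]$ denotes the real polynomials of degree at most $n$. A univariate polynomial is hyperbolic if it is non-zero, has real coefficients and all its zeros are real. A polynomial $f\in\mathbb C[z_1,\dots,z_k]$ is stable if it is non-zero and $f(z_1,\dots,z_k)\neq0$ whenever $\Im z_j>0$ for all $j$; it is real stable if moreover it has real coefficients. $\mathcal H_k(\mathbb C)$ (resp. $\mathcal H_k(\mathbb R)$) is the set of stable (resp. real stable) polynomials in $k$ variables. The zeros $\alpha_1\le\dots\le\alpha_p$ and $\beta_1\le\dots\le\beta_q$ of two hyperbolic polynomials interlace if either $\alpha_1\le\beta_1\le\alpha_2\le\beta_2\le\cdots$ or $\beta_1\le\alpha_1\le\beta_2\le\alpha_2\le\cdots$; by convention the zeros of any two polynomials of degree $0$ or $1$ interlace. A linear operator $T$ on univariate polynomials in $z$ is extended to polynomials in $z,w$ by $T(z^kw^\ell)=T(z^k)w^\ell$.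 *)

(* Defs.v *)
From HB Require Import structures.
From mathcomp Require Import all_boot all_order all_algebra.
From mathcomp Require Import reals.
From mathcomp Require Import complex.
Set Implicit Arguments. Unset Strict Implicit. Unset Printing Implicit Defensive.
Import Order.TTheory GRing.Theory Num.Theory.
Local Open Scope ring_scope.

Section Defs.
Variable R : realType.

Definition RtoC (x : R) : R[i] := Complex x 0.

Definition hyperbolic (p : {poly R}) : Prop :=
  p != 0 /\ forall z : R[i], root (map_poly RtoC p) z -> complex.Im z = 0.

(* bivariate polynomials in z, w: {poly {poly R}}, outer variable w ('X),
   inner variable z ('X%:P).  eval2 p z w = p(z, w). *)
Definition eval2 (p : {poly {poly R}}) (z w : R[i]) : R[i] :=
  (map_poly (fun q : {poly R} => (map_poly RtoC q).[z]) p).[w].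

Definition real_stable2 (p : {poly {poly R}}) : Prop :=
  p != 0 /\ forall z w : R[i], 0 < complex.Im z -> 0 < complex.Im w -> eval2 p z w != 0.

Fixpoint interleave (a b : seq R) {struct a} : seq R :=
  match a, b with
  | x :: a', y :: b' => x :: y :: interleave a' b'
  | [::], _ => b
  | _, [::] => a
  end.

Definition interlace_seq (a b : seq R) : Prop :=
  (size b = size a \/ (size b).+1 = size a) /\ sorted <=%R (interleave a b).

Definition zero_list (p : {poly R}) (s : seq R) : Prop :=
  sorted <=%R s /\ p = lead_coef p *: \prod_(x <- s) ('X - x%:P).

Definition zeros_interlace (P Q : {poly R}) : Prop :=
  exists a b, zero_list P a /\ zero_list Q b /\ (interlace_seq a b \/ interlace_seq b a).

Definition linear_on (n : nat) (T : {poly R} -> {poly R}) : Prop :=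
  forall (c : R) (f g : {poly R}), (size f <= n.+1)%N -> (size g <= n.+1)%N ->
    T (c *: f + g) = c *: T f + T g.

Definition lin_functional_on (n : nat) (a : {poly R} -> R) : Prop :=
  forall (c : R) (f g : {poly R}), (size f <= n.+1)%N -> (size g <= n.+1)%N ->
    a (c *: f + g) = c * a f + a g.

Definition preserves_hyperbolicity (n : nat) (T : {poly R} -> {poly R}) : Prop :=
  forall f : {poly R}, (size f <= n.+1)%N -> hyperbolic f -> hyperbolic (T f) \/ T f = 0.

(* extension of T to polynomials in z, w: T(z^k w^l) = T(z^k) w^l *)
Definition extT (T : {poly R} -> {poly R}) (p : {poly {poly R}}) : {poly {poly R}} :=
  map_poly T p.

End Defs.

(* Main.v *)
Require Import Defs.
From HB Require Import structures.
From mathcomp Require Import all_boot all_order all_algebra.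
From mathcomp Require Import reals complex.
From mathcomp Require Import polyrcf boolp ring lra.
Set Implicit Arguments. Unset Strict Implicit. Unset Printing Implicit Defensive.
Import Order.TTheory GRing.Theory Num.Theory.
Local Open Scope ring_scope.

(** Write S(z,w) = T[(z+w)^n] and let c be a nonzero complex number. If (b) holds,
    S(z,.) has no zero in the upper half-plane, and Grace's theorem (iterated
    Laguerre polar derivatives) gives T(f)(z) <> 0 for f of degree n with all
    zeros in the open lower half-plane; Hurwitz's theorem then covers real zeros
    and lower degrees. (c) is (b) for f |-> T(f(-z)). If (a) holds, P conj(Q) has
    as argument an alternating sum of increasing arguments, so its imaginary part
    has a constant sign on the upper half-plane.

    Conversely, for Im w > 0 the real polynomial f = 2 Re (c (x+w)^n) has only
    simple real zeros and degree at least n-1, and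
    T(f)(z) = c S(z,w) + conj(c) S(z,conj w). If |S(z,w)| = |S(z,conj w)| for some
    z, w in the upper half-plane, a suitable c gives T(f)(z) = 0, hence T(f) = 0;
    as f + e g is hyperbolic for every g and small e, every T(g) is hyperbolic or
    zero, and evaluation at i shows that the range has dimension at most two,
    which is (a) by the Obreschkoff theorem. Otherwise |S(z,w)| - |S(z,conj w)|
    has a constant sign on a connected set, and the sign decides between (b)
    and (c). *)

(** * Complex polynomials and Hurwitz's theorem *)

Section ComplexBasics.
Variable R : realType.
Local Notation C := (complex R).
Local Notation rc := (real_complex R).
Implicit Types (z w : C) (x y : R).

Lemma cReD z w : complex.Re (z + w) = complex.Re z + complex.Re w.
Proof. by case: z; case: w. Qed.
Lemma cImD z w : complex.Im (z + w) = complex.Im z + complex.Im w.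
Proof. by case: z; case: w. Qed.
Lemma cReN z : complex.Re (- z) = - complex.Re z.
Proof. by case: z. Qed.
Lemma cImN z : complex.Im (- z) = - complex.Im z.
Proof. by case: z. Qed.
Lemma cReM z w : complex.Re (z * w) =
  complex.Re z * complex.Re w - complex.Im z * complex.Im w.
Proof. by case: z; case: w. Qed.
Lemma cImM z w : complex.Im (z * w) =
  complex.Re z * complex.Im w + complex.Im z * complex.Re w.
Proof. by case: z; case: w. Qed.
Lemma cReJ z : complex.Re (conjc z) = complex.Re z. Proof. by case: z. Qed.
Lemma cImJ z : complex.Im (conjc z) = - complex.Im z. Proof. by case: z. Qed.

Lemma cRe0 : complex.Re (0 : C) = 0. Proof. by []. Qed.
Lemma cIm0 : complex.Im (0 : C) = 0. Proof. by []. Qed.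

Definition reimE := (cRe0, cIm0, cReD, cImD, cReN, cImN, cReM, cImM, cReJ, cImJ).

Lemma complex_ext z w : complex.Re z = complex.Re w ->
  complex.Im z = complex.Im w -> z = w.
Proof. by case: z; case: w => a b c d /= -> ->. Qed.

Lemma RtoC_rc (p : {poly R}) : map_poly (@RtoC R) p = map_poly rc p.
Proof. by []. Qed.

Lemma map_rc_inj : injective (map_poly rc).
Proof. exact: map_poly_inj. Qed.

Lemma conj_map_rc (p : {poly R}) z :
  (map_poly rc p).[conjc z] = conjc (map_poly rc p).[z].
Proof.
rewrite -horner_map /= -map_poly_comp /=; congr (_.[_]).
by apply: eq_map_poly => x /=; rewrite /= oppr0.
Qed.

Lemma hornerRC (p : {poly R}) x : (map_poly rc p).[rc x] = rc p.[x].
Proof. exact: horner_map. Qed.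

(** Unordered variant of [zero_list]; sorting is left to the proofs that need it. *)
Definition zlist (p : {poly R}) (s : seq R) :=
  p = lead_coef p *: \prod_(x <- s) ('X - x%:P).

Lemma hyperbolic_split (p : {poly R}) : hyperbolic p -> exists s, zlist p s.
Proof.
case=> p0 hp.
have [r Dr] := closed_field_poly_normal (map_poly rc p).
have rr : forall z, z \in r -> rc (complex.Re z) = z.
  move=> z zr; apply: complex_ext => //=.
  rewrite hp // RtoC_rc Dr rootZ ?lead_coef_eq0 ?map_poly_eq0 //.
  by rewrite root_prod_XsubC.
exists (map (@complex.Re R) r); rewrite /zlist.
apply: map_rc_inj; rewrite Dr lead_coef_map map_polyZ /=; congr (_ *: _).
rewrite big_map rmorph_prod /= big_seq [RHS]big_seq; apply: eq_bigr => z zr.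
by rewrite rmorphB /= map_polyX map_polyC /= rr.
Qed.

Lemma prodXsubC_neq0 (K : fieldType) (s : seq K) :
  \prod_(x <- s) ('X - x%:P) != 0.
Proof. exact/monic_neq0/monic_prod_XsubC. Qed.

Lemma split_hyperbolic (k : R) (s : seq R) : k != 0 ->
  hyperbolic (k *: \prod_(x <- s) ('X - x%:P)).
Proof.
move=> k0; split; first by rewrite scaler_eq0 negb_or k0 prodXsubC_neq0.
move=> z; rewrite RtoC_rc map_polyZ rootZ ?fmorph_eq0 //= rmorph_prod /=.
under eq_bigr do rewrite rmorphB /= map_polyX map_polyC /=.
rewrite -(big_map rc xpredT (fun y : C => 'X - y%:P)) root_prod_XsubC.
by case/mapP => x _ ->.
Qed.

Lemma hyperbolic_nouhp (p : {poly R}) : p != 0 ->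
  (forall z, 0 < complex.Im z -> (map_poly rc p).[z] != 0) -> hyperbolic p.
Proof.
move=> p0 h; split=> // z; rewrite RtoC_rc => /rootP hz.
case: (ltgtP (complex.Im z) 0) => // hI.
  have := h (conjc z); rewrite cImJ oppr_gt0 hI => /(_ isT).
  by rewrite conj_map_rc hz conjc0 eqxx.
by have := h z hI; rewrite hz eqxx.
Qed.

Lemma hyperbolic_neq0 (p : {poly R}) z : hyperbolic p ->
  complex.Im z != 0 -> (map_poly rc p).[z] != 0.
Proof. by move=> [_ h]; apply: contra => hz; apply/eqP/h. Qed.

Lemma hyperbolicZ (k : R) p : k != 0 -> hyperbolic p -> hyperbolic (k *: p).
Proof.
move=> k0 [p0 h]; split; first by rewrite scaler_eq0 negb_or k0.
by move=> z; rewrite RtoC_rc map_polyZ rootZ ?fmorph_eq0 //; exact: h.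
Qed.

(** For G = p X + c the increment from 0 to e is p(e) e, and p(e) is bounded by |p(0)| plus the
    bound already found for p. *)
Lemma poly_near0 (G : {poly C}) : exists2 M : C, 0 <= M &
  forall e : R, 0 <= e -> e <= 1 -> `|G.[rc e] - G.[0]| <= M * rc e.
Proof.
elim/poly_ind: G => [|p c [M M0 IH]].
  by exists 0 => // e _ _; rewrite !horner0 subrr normr0 mul0r.
exists (`|p.[0]| + M) => [|e e0 e1]; first by rewrite addr_ge0.
have ge : (0 : C) <= rc e by rewrite lecR.
rewrite [X in `|X|](_ : _ = p.[rc e] * rc e); last by rewrite !hornerE; ring.
rewrite normrM (ger0_norm ge).
apply: ler_wpM2r => //; rewrite -[p.[rc e]](subrKC p.[0]).
apply: le_trans (ler_normD _ _) _; apply: lerD => //.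
apply: le_trans (IH e e0 e1) _; rewrite -[leRHS]mulr1 ler_wpM2l // lecR //.
Qed.

Lemma lim_norm_le (F G : {poly C}) (k : C) : 0 <= k ->
  (forall e : R, 0 < e -> e < 1 -> `|F.[rc e]| <= k * `|G.[rc e]|) ->
  G.[0] = 0 -> F.[0] = 0.
Proof.
move=> k0 h G0; have [M M0 hM] := poly_near0 F; have [N N0 hN] := poly_near0 G.
apply/eqP; rewrite -normr_eq0; apply/negPn/negP => F0.
have F1 : 0 < `|F.[0]| by rewrite lt_def F0 /=.
have key (e : R) : 0 < e -> e < 1 -> `|F.[0]| <= (M + k * N) * rc e.
  move=> e0 e1; have [e0' e1'] := (ltW e0, ltW e1).
  rewrite -[F.[0]](subrKC F.[rc e]) mulrDl addrC.
  apply: le_trans (ler_normD _ _) _; apply: lerD.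
    by rewrite distrC hM.
  apply: le_trans (h e e0 e1) _; rewrite -mulrA ler_wpM2l //.
  by have := hN e e0' e1'; rewrite G0 subr0.
have [a ha] : exists a, M + k * N = rc a.
  have : 0 <= M + k * N by rewrite addr_ge0 // mulr_ge0.
  by move/ger0_Im => hh; exists (complex.Re (M + k * N)); apply: complex_ext.
have [b hb] : exists b, `|F.[0]| = rc b.
  by move/ltW/ger0_Im: F1 => hh; exists (complex.Re `|F.[0]|); apply: complex_ext.
have b0 : 0 < b by rewrite -(ltcR 0) -hb.
have a0 : 0 <= a.
  by rewrite -(lecR 0) -ha; rewrite addr_ge0 // mulr_ge0.
have b1 : 0 < 2 + 2 * a + b by lra.
(* This e lies in (0,1) and satisfies a e < b, against [key]. *)
pose e := b / (2 + 2 * a + b).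
have e0 : 0 < e by rewrite divr_gt0.
have e1 : e < 1 by rewrite /e ltr_pdivrMr //; lra.
have := key e e0 e1; rewrite hb ha -rmorphM /= lecR /e mulrA ler_pdivlMr //; nra.
Qed.

Lemma prod_norm_le (s : seq C) z0 z1 :
  (forall r, r \in s -> `|z1 - r| <= 2 * `|z0 - r|) ->
  `|(\prod_(r <- s) ('X - r%:P)).[z1]| <= 2 ^+ size s * `|(\prod_(r <- s) ('X - r%:P)).[z0]|.
Proof.
elim: s => [|r s IH] h; first by rewrite !big_nil !hornerE /= ?expr0 ?mul1r.
rewrite !big_cons !hornerM !hornerXsubC !normrM exprS mulrACA.
apply: ler_pM => //; first by apply: h; rewrite mem_head.
by apply: IH => t ts; apply: h; rewrite inE ts orbT.
Qed.

Lemma normc_leE (a b : C) : (`|a| <= `|b|) =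
  (complex.Re a ^+ 2 + complex.Im a ^+ 2 <= complex.Re b ^+ 2 + complex.Im b ^+ 2).
Proof. by rewrite !normc_def lecR ler_sqrt // addr_ge0 ?sqr_ge0. Qed.

Definition no_uhp (p : {poly C}) := forall z, 0 < complex.Im z -> p.[z] != 0.

(** Every root t has Im t <= 0, so |z0 - t| >= Im z0 >= |z1 - z0|, and each linear factor at most
    doubles from z0 to z1. *)
Lemma no_uhp_growth (p : {poly C}) (N : nat) (z0 z1 : C) : no_uhp p ->
  (size p <= N)%N -> 0 < complex.Im z0 -> `|z1 - z0| <= rc (complex.Im z0) ->
  `|p.[z1]| <= 2 ^+ N * `|p.[z0]|.
Proof.
move=> hp sp I0 hz.
have p0 : p != 0 by apply/eqP => p0; have := hp _ I0; rewrite p0 horner0 eqxx.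
have [r Dr] := closed_field_poly_normal p.
have rI : forall t, t \in r -> complex.Im t <= 0.
  move=> t tr; rewrite leNgt; apply/negP => /hp; rewrite Dr hornerZ mulf_eq0.
  by rewrite (rootP (_ : root _ t)) ?eqxx ?orbT // root_prod_XsubC.
have sr : (size r <= N)%N.
  apply: leq_trans sp; rewrite Dr size_scale ?lead_coef_eq0 //.
  by rewrite size_prod_XsubC.
have h : forall t, t \in r -> `|z1 - t| <= 2 * `|z0 - t|.
  move=> t tr; rewrite mulr_natl mulr2n -[z1 - t](subrKA z0).
  apply: le_trans (ler_normD _ _) _; rewrite lerD2r; apply: le_trans hz _.
  apply: le_trans (_ : rc (complex.Im (z0 - t)) <= _).
    by rewrite lecR reimE; have := rI _ tr; lra.
  have h0 : 0 <= complex.Im (z0 - t) by rewrite reimE; have := rI _ tr; lra.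
  have -> : rc (complex.Im (z0 - t)) = `|rc (complex.Im (z0 - t))|.
    by rewrite ger0_norm // lecR.
  by rewrite normc_leE /= expr0n addr0 lerDr sqr_ge0.
rewrite Dr !hornerZ !normrM mulrCA ler_wpM2l //.
apply: le_trans (prod_norm_le h) _; rewrite ler_wpM2r //.
by rewrite ler_weXn2l // (ler_nat _ 1 2).
Qed.

(** The growth bound is uniform in e because the degrees are bounded. In the limit, a zero z0 of
    [F 0] forces [F 0] to vanish on the whole disc of centre z0 and radius Im z0, hence
    identically. *)
Lemma hurwitz (F : R -> {poly C}) (N : nat) :
  (forall e, size (F e) <= N)%N ->
  (forall z, exists G : {poly C}, forall e, (F e).[z] = G.[rc e]) ->
  (forall e, 0 < e -> e < 1 -> no_uhp (F e)) ->
  F 0 = 0 \/ no_uhp (F 0).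
Proof.
move=> sF cF hF; case: (eqVneq (F 0) 0) => [|F0]; [by left|right].
move=> z0 I0; apply/negP => /eqP hz0.
have key z1 : `|z1 - z0| <= rc (complex.Im z0) -> (F 0).[z1] = 0.
  move=> hz; have [G1 h1] := cF z1; have [G0 h0] := cF z0.
  rewrite h1 (_ : rc 0 = 0) //.
  apply: (@lim_norm_le G1 G0 (2 ^+ N)); first by rewrite exprn_ge0.
    by move=> e e0 e1; rewrite -h1 -h0; apply: no_uhp_growth => //; apply: hF.
  by rewrite -[0 in LHS]/(rc 0) -h0.
(* Distinct points of that disc, of which one takes more than the degree of [F 0]. *)
pose pt (k : nat) := z0 + rc (complex.Im z0 / k.+1%:R).
have ipt : injective pt.
  move=> i j /addrI [] /mulfI; rewrite gt_eqF // => /(_ isT) /invr_inj /eqP.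
  by rewrite eqr_nat => /eqP [].
have := @max_poly_roots _ (F 0) (map pt (iota 0 (size (F 0)))) F0.
rewrite size_map size_iota ltnn; set s := map pt _.
suff [-> ->] : all (root (F 0)) s /\ uniq s by move=> /(_ isT isT).
split.
- apply/allP => _ /mapP [k _ ->]; apply/rootP/key.
  rewrite /pt addrAC subrr add0r.
  have h : 0 <= complex.Im z0 / k.+1%:R by rewrite divr_ge0 // ltW.
  rewrite ger0_norm lecR // ler_pdivrMr ?ltr0n // -[leLHS]mulr1.
  by rewrite ler_wpM2l ?(ltW I0) // ler1n.
- by rewrite map_inj_uniq ?iota_uniq.
Qed.

Lemma coef_XaddC_exp (v : C) n i : (i <= n)%N ->
  (('X + v%:P) ^+ n)`_i = v ^+ (n - i) *+ 'C(n, i).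
Proof.
move=> li; rewrite addrC exprDn coef_sum (bigD1 (inord i)) //= inordK ?ltnS //.
rewrite big1 ?addr0 => [|j ji].
  by rewrite -polyC_exp coefMn mul_polyC coefZ coefXn eqxx mulr1.
rewrite coefMn -polyC_exp mul_polyC coefZ coefXn.
have -> : (i == j :> nat) = false.
  by apply: contraNF ji => /eqP ->; rewrite inord_val.
by rewrite mulr0 mul0rn.
Qed.

End ComplexBasics.

(** * Grace's theorem *)

Section Grace.
Variable R : realType.
Local Notation C := (complex R).
Local Notation rc := (real_complex R).

(** The function w |-> L((X+w)^n) as a polynomial, so that it can be factored and differentiated. *)
Definition symb (n : nat) (L : {poly C} -> C) : {poly C} :=
  \poly_(i < n.+1) ('C(n, i)%:R * L 'X^(n - i)).

Lemma symbE n (L : {scalar {poly C}}) w :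
  (symb n L).[w] = L (('X + w%:P) ^+ n).
Proof.
rewrite horner_poly exprDn linear_sum /=; apply: eq_bigr => i _.
rewrite -polyC_exp [in RHS]mulrC mul_polyC linearMn linearZ /=.
by rewrite -[in RHS]mulr_natl; ring.
Qed.

Lemma symb_deriv n (L : {scalar {poly C}}) w :
  (symb n.+1 L)^`().[w] = n.+1%:R * L (('X + w%:P) ^+ n).
Proof.
rewrite -symbE -hornerZ; congr (_.[w]); apply/polyP => i.
rewrite coef_deriv coefZ !coef_poly ltnS; case: ltnP => _; last first.
  by rewrite mulr0 mul0rn.
rewrite subSS -[LHS]mulr_natl !mulrA -!natrM; congr (_%:R * _).
by rewrite -mul_bin_diag.
Qed.

Lemma prodXsubC_logderiv (s : seq C) w : w \notin s ->
  (\prod_(r <- s) ('X - r%:P))^`().[w] =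
  (\prod_(r <- s) ('X - r%:P)).[w] * \sum_(r <- s) (w - r)^-1.
Proof.
elim: s => [|r s IH]; first by rewrite !big_nil derivC !horner0 mulr0.
rewrite inE negb_or => /andP[wr ws]; rewrite !big_cons derivM derivXsubC.
rewrite mul1r hornerD !hornerM hornerXsubC IH //.
have h : w - r != 0 by rewrite subr_eq0.
by field.
Qed.

(* With y = Im w, the inversion
   r |-> 1/(w - r) maps the half-plane Im r <= 0 into the disc of centre
   -i/(2y) and radius 1/(2y), which also contains 0. *)
Lemma laguerre n (L : {scalar {poly C}}) (zeta : C) :
  (forall w, 0 < complex.Im w -> L (('X + w%:P) ^+ n.+1) != 0) ->
  complex.Im zeta < 0 ->
  forall w, 0 < complex.Im w -> L (('X - zeta%:P) * ('X + w%:P) ^+ n) != 0.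
Proof.
move=> hL hz w Iw; set g := symb n.+1 L.
have gn0 v : 0 < complex.Im v -> g.[v] != 0 by move=> hv; rewrite symbE hL.
have g0 : g != 0 by apply/eqP => h; have := gn0 w Iw; rewrite h horner0 eqxx.
have [s Dg] := closed_field_poly_normal g.
have sI t : t \in s -> complex.Im t <= 0.
  move=> ts; rewrite leNgt; apply/negP => /gn0; rewrite Dg hornerZ mulf_eq0.
  by rewrite (rootP (_ : root _ t)) ?eqxx ?orbT // root_prod_XsubC.
have ss : (size s <= n.+1)%N.
  have := size_poly n.+2 (fun i => 'C(n.+1, i)%:R * L 'X^(n.+1 - i)).
  rewrite -/(symb n.+1 L) -/g Dg size_scale ?lead_coef_eq0 //.
  by rewrite size_prod_XsubC.
have ws : w \notin s by apply/negP => /sI; rewrite leNgt Iw.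
set S := \sum_(r <- s) (w - r)^-1.
have dg : n.+1%:R * L (('X + w%:P) ^+ n) = g.[w] * S.
  rewrite -symb_deriv -/g Dg derivZ !hornerZ prodXsubC_logderiv //.
  by rewrite mulrA.
(* Writing X - zeta as (X + w) - (w + zeta) yields g(w) - (w + zeta) g'(w) / (n+1), the polar
   derivative of g. *)
have e1 : ('X - zeta%:P) * ('X + w%:P) ^+ n =
   ('X + w%:P) ^+ n.+1 - (w + zeta) *: ('X + w%:P) ^+ n.
  by rewrite exprS -mul_polyC polyCD; ring.
rewrite e1 linearB linearZ /= -symbE -/g.
have n1 : (n.+1%:R : C) != 0 by rewrite pnatr_eq0.
apply/negP => /eqP h.
have h2 : n.+1%:R = (w + zeta) * S.
  apply: (mulfI (gn0 w Iw)).
  rewrite mulrCA -dg mulrCA; apply/eqP; rewrite mulrC -subr_eq0 -mulrBr.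
  by rewrite h mulr0.
have wz : w + zeta != 0.
  by apply: contra_neq n1 => h3; rewrite h2 h3 mul0r.
(* Minus the centre of the disc; |a| is its radius. *)
pose a : C := Complex 0 (2 * complex.Im w)^-1.
have aE : `|a| = rc (2 * complex.Im w)^-1.
  have h3 : 0 < (2 * complex.Im w)^-1 by rewrite invr_gt0; lra.
  rewrite normc_def /= expr0n add0r sqrtr_sqr ger0_norm // ltW //.
have a0 : a != 0 by rewrite -normr_gt0 aE ltcR invr_gt0; lra.
have aV : a^-1 = Complex 0 (- (2 * complex.Im w)).
  apply: (mulfI a0); rewrite mulfV //; apply: complex_ext; rewrite !reimE /=.
    by field; rewrite gt_eqF.
  by ring.
have pt v : v != 0 -> `|v^-1 + a| = `|v + a^-1| * `|v|^-1 * `|a|.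
  move=> v0; rewrite -normfV -mulrA -!normrM; congr `|_|.
  by rewrite mulrDl mulrA mulfV // mul1r [v^-1 * a]mulrC mulKf // addrC.
have in_disc t : t \in s -> `|(w - t)^-1 + a| <= `|a|.
  move=> ts; have It := sI t ts.
  have v0 : w - t != 0 by apply: contra ws; rewrite subr_eq0 => /eqP ->.
  rewrite pt // -[leRHS]mul1r ler_wpM2r // ler_pdivrMr ?normr_gt0 // mul1r.
  by rewrite aV normc_leE !reimE /=; nra.
(* S/(n+1) is a mean of n+1 points of the disc: when g has fewer than n+1 roots, the missing terms
   count as 0, which also lies in the disc. *)
have big_disc : `|S + n.+1%:R * a| <= n.+1%:R * `|a|.
  rewrite /S; clear -in_disc ss; elim: s n ss in_disc => [|t s IH] n ss hs.
    by rewrite big_nil add0r normrM normr_nat.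
  case: n ss => [|n] ss.
    move: ss; rewrite ltnS leqn0 size_eq0 => /eqP s0; rewrite s0 big_cons big_nil addr0 !mul1r.
    by apply: hs; rewrite mem_head.
  rewrite big_cons -[n.+2%:R]natr1 !mulrDl !mul1r [X in X + _]addrC addrACA.
  apply: le_trans (ler_normD _ _) _; apply: lerD.
    by apply: IH => // u us; apply: hs; rewrite inE us orbT.
  by apply: hs; rewrite mem_head.
(* By [h2] this mean is 1/(w - r) with r = -zeta in the open upper half-plane, a point outside the
   disc. *)
have : `|S + n.+1%:R * a| = n.+1%:R * (`|(w + zeta)^-1 + a|).
  rewrite -[n.+1%:R in RHS]normr_nat -normrM; congr `|_|.
  by rewrite mulrDr; congr (_ + _); rewrite h2 mulrAC mulfV // mul1r.
move=> h4; move: big_disc; rewrite h4 ler_pM2l ?ltr0n // pt //.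
rewrite -[leRHS]mul1r ler_pM2r ?normr_gt0 // ler_pdivrMr ?normr_gt0 // mul1r.
rewrite aV normc_leE !reimE /=; nra.
Qed.

(** The zeros are peeled off one at a time: by [laguerre], the functional h |-> L((X - t) h)
    satisfies the hypothesis with the exponent lowered by one. *)
Lemma grace n (L : {scalar {poly C}}) (s : seq C) :
  (forall w, 0 < complex.Im w -> L (('X + w%:P) ^+ n) != 0) ->
  size s = n -> (forall t, t \in s -> complex.Im t < 0) ->
  L (\prod_(t <- s) ('X - t%:P)) != 0.
Proof.
elim: s n L => [|t s IH] n L hL sn hs.
  have := hL (Complex 0 1); rewrite -sn expr0 big_nil; apply.
  exact: ltr01.
case: n sn hL => // n [sn] hL.
pose L' (h : {poly C}) := L (('X - t%:P) * h).
have linL' : scalar L'.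
  by move=> a f g; rewrite /L' mulrDr -scalerAr linearP.
pose L1 : {scalar {poly C}} := HB.pack L' (GRing.isLinear.Build C {poly C} C *%R L' linL').
rewrite big_cons; apply: (IH n L1) => //.
  move=> w Iw; apply: laguerre => //.
  by apply: hs; rewrite mem_head.
by move=> u us; apply: hs; rewrite inE us orbT.
Qed.

End Grace.

(** * Symbols *)

Section Symbol.
Variable R : realType.
Local Notation C := (complex R).
Local Notation rc := (real_complex R).
Variables (n : nat) (T : {poly R} -> {poly R}).
Hypothesis hT : linear_on n T.

(** The complexification of T. Truncation at degree n makes it linear on all polynomials, whereas T
    is known to be linear only up to degree n. *)
Definition cxT (f : {poly C}) : {poly C} :=
  \sum_(i < n.+1) f`_i *: map_poly rc (T 'X^i).

Lemma linear_on0 : T 0 = 0.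
Proof.
have := @hT (-1) 0 0; rewrite size_poly0 => /(_ isT isT).
by rewrite scaler0 addr0 scaleN1r addNr.
Qed.

Lemma linear_onZ (c : R) (f : {poly R}) : (size f <= n.+1)%N -> T (c *: f) = c *: T f.
Proof.
by move=> sf; have := @hT c f 0 sf; rewrite size_poly0 !addr0 linear_on0 addr0; apply.
Qed.

Lemma linear_on_sum (I : Type) (r : seq I) (P : pred I) (F : I -> {poly R}) (c : I -> R) :
  (forall i, P i -> (size (F i) <= n.+1)%N) ->
  T (\sum_(i <- r | P i) c i *: F i) = \sum_(i <- r | P i) c i *: T (F i).
Proof.
move=> sF; elim: r => [|i r IH]; first by rewrite !big_nil linear_on0.
rewrite !big_cons; case: ifP => // Pi; rewrite hT ?IH ?sF //.
apply: (big_ind (fun p : {poly R} => (size p <= n.+1)%N)) => [|p q sp sq|j Pj].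
- by rewrite size_poly0.
- by apply: leq_trans (size_polyD _ _) _; rewrite geq_max sp.
- exact: leq_trans (size_scale_leq _ _) (sF _ Pj).
Qed.

Lemma cxT_is_linear : linear cxT.
Proof.
move=> a f g; rewrite /cxT scaler_sumr -big_split /=; apply: eq_bigr => i _.
by rewrite coefD coefZ scalerDl scalerA.
Qed.
HB.instance Definition _ := GRing.isLinear.Build C {poly C} {poly C} _ cxT cxT_is_linear.

Lemma cxT_map (f : {poly R}) : (size f <= n.+1)%N -> cxT (map_poly rc f) = map_poly rc (T f).
Proof.
move=> sf; rewrite -{2}[f](coefK) (@poly_def R (size f)).
rewrite (big_ord_widen _ (fun i => f`_i *: 'X^i) sf) linear_on_sum; last first.
  by move=> i _; rewrite size_polyXn.
rewrite rmorph_sum /= /cxT [RHS]big_mkcond /=; apply: eq_bigr => i _.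
rewrite coef_map /= map_polyZ /=; case: ltnP => // si.
by rewrite nth_default //= scale0r.
Qed.

(** The bound does not depend on f, as [hurwitz] requires. *)
Lemma cxT_size (f : {poly C}) :
  (size (cxT f) <= \max_(i < n.+1) size (map_poly rc (T 'X^i)))%N.
Proof.
apply: leq_trans (size_sum _ _ _) _; apply/bigmax_leqP => i _.
apply: leq_trans (size_scale_leq _ _) _.
exact: (leq_bigmax_cond (F := fun i : 'I_n.+1 => size (map_poly rc (T 'X^i)))).
Qed.

Lemma eval2_extT (p : {poly {poly R}}) z w :
  (forall i, (size (p`_i)%R <= n.+1)%N) ->
  eval2 (extT T p) z w = (cxT (map_poly (map_poly rc) p).[w%:P]).[z].
Proof.
move=> sp; have T0 := linear_on0; rewrite /eval2 /extT.
rewrite (@horner_coef_wide _ (size p)); last first.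
  exact: leq_trans (size_poly _ _) (size_poly _ _).
rewrite [(map_poly (map_poly rc) p).[_]](@horner_coef_wide _ (size p)); last exact: size_poly.
rewrite linear_sum horner_sum; apply: eq_bigr => i _.
rewrite !coef_map_id0 ?T0 ?RtoC_rc ?rmorph0 ?horner0 //.
by rewrite -cxT_map // -polyC_exp [in RHS]mulrC mul_polyC linearZ hornerZ mulrC.
Qed.

(** For each fixed z, Grace's theorem is applied to the functional g |-> (cxT g)(z). *)
Lemma symbol_preserves :
  (forall z w, 0 < complex.Im z -> 0 < complex.Im w ->
     (cxT (('X + w%:P) ^+ n)).[z] != 0) ->
  preserves_hyperbolicity n T.
Proof.
move=> hS f sf hf; have [s Df] := hyperbolic_split hf.
have [f0 _] := hf.
have ss : (size s <= n)%N.
  by move: sf; rewrite Df size_scale ?lead_coef_eq0 // size_prod_XsubC ltnS.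
pose k := (n - size s)%N.
(* the zeros are pushed by e into the lower half-plane and n - deg f further
   zeros are added at the point -i/e *)
pose Y : {poly C} := 'i%C *: 'X.
pose F2 : {poly {poly C}} := (rc (lead_coef f))%:P *:
   (\prod_(x <- s) ('X - (rc x)%:P%:P + Y%:P) * (1 - Y *: 'X) ^+ k).
(* The inner variable of [F2] stands for e and the outer one for z, so the dependence on e is
   visibly polynomial, as [hurwitz] asks. *)
pose fe (e : R) : {poly C} := map_poly (horner_eval (rc e)) F2.
have feE e : fe e = rc (lead_coef f) *:
   (\prod_(x <- s) ('X - (rc x - 'i%C * rc e)%:P) * (1 - ('i%C * rc e) *: 'X) ^+ k).
  rewrite /fe /F2 map_polyZ /= horner_evalE hornerC rmorphM rmorph_prod /= rmorphXn /=.
  congr (_ *: (_ * _ ^+ _)).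
    apply: eq_bigr => x _; rewrite rmorphD rmorphB /= map_polyX !map_polyC /= !horner_evalE.
    by rewrite hornerC /Y hornerZ hornerX polyCB opprB addrA addrAC.
  by rewrite rmorphB rmorph1 /= map_polyZ /= map_polyX horner_evalE /Y hornerZ hornerX.
have key e : 0 < e -> e < 1 -> no_uhp (cxT (fe e)).
  move=> e0 e1 z Iz; rewrite feE.
  have ie0 : 'i%C * rc e != 0 :> C.
    apply: mulf_neq0; last by rewrite fmorph_eq0 gt_eqF.
    by rewrite eq_complex /= oner_eq0 andbF.
  pose t : C := ('i%C * rc e)^-1.
  have -> : (1 - ('i%C * rc e) *: 'X) = (- ('i%C * rc e)) *: ('X - t%:P).
    rewrite scalerBr -[X in _ = _ - X]mul_polyC -polyCM mulNr mulfV //.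
    by rewrite scaleNr polyCN opprK addrC.
  rewrite exprZn -scalerAr !linearZ /= !hornerZ.
  rewrite mulf_neq0 ?fmorph_eq0 ?lead_coef_eq0 //.
  rewrite mulf_neq0 ?expf_neq0 ?oppr_eq0 //.
  pose L (g : {poly C}) := (cxT g).[z].
  have linL : scalar L by move=> a g h; rewrite /L linearP hornerD hornerZ.
  pose L1 : {scalar {poly C}} :=
    HB.pack L (GRing.isLinear.Build C {poly C} C *%R L linL).
  pose s' := [seq rc x - 'i%C * rc e | x <- s] ++ nseq k t.
  have -> : \prod_(x <- s) ('X - (rc x - 'i%C * rc e)%:P) * ('X - t%:P) ^+ k
     = \prod_(u <- s') ('X - u%:P).
    by rewrite big_cat big_map /=; congr (_ * _); rewrite big_nseq iter_mulr_1.
  apply: (@grace _ n L1).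
  - by move=> w Iw; apply: hS.
  - by rewrite size_cat size_map size_nseq subnKC.
  - move=> u; rewrite mem_cat => /orP [/mapP [x _ ->]|/nseqP [-> _]].
      by rewrite !reimE /=; lra.
    have tt : t * ('i%C * rc e) = 1 by rewrite mulVf.
    have := congr1 (@complex.Re R) tt; have := congr1 (@complex.Im R) tt.
    rewrite !reimE /=; nra.
have := @hurwitz R (fun e => cxT (fe e)) _ (fun e => cxT_size _) _ key.
have f00 : fe 0 = map_poly rc f.
  rewrite feE rmorph0 mulr0 scale0r subr0 expr1n mulr1 [in RHS]Df map_polyZ /=.
  congr (_ *: _); rewrite rmorph_prod /=; apply: eq_bigr => x _.
  by rewrite [RHS]rmorphB /= map_polyX map_polyC /= subr0.
rewrite f00 cxT_map //; case.
- move=> z; exists (\sum_(i < n.+1) (map_poly rc (T 'X^i)).[z] *: F2`_i) => e.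
  rewrite /cxT !horner_sum; apply: eq_bigr => i _.
  by rewrite !hornerZ mulrC coef_map.
- by move/eqP; rewrite map_poly_eq0 => /eqP; right.
move=> nu; case: (eqVneq (T f) 0) => [|Tf0]; [by right|left].
by apply: hyperbolic_nouhp.
Qed.

End Symbol.

(** * Sufficiency of the three conditions *)

Section Sufficiency.
Variable R : realType.
Local Notation C := (complex R).
Local Notation rc := (real_complex R).

Lemma size_coef_linear_exp (a : R) n i :
  (size ((('X%:P + a%:P *: 'X : {poly {poly R}}) ^+ n)`_i)%R <= n.+1)%N.
Proof.
elim: n i => [|n IH] i.
  by rewrite expr0 coef1; case: eqP => _; rewrite ?size_poly1 ?size_poly0.
rewrite exprSr mulrDr coefD coefMC -scalerAr coefZ coefMX.
apply: leq_trans (size_polyD _ _) _; rewrite geq_max; apply/andP; split.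
  by rewrite (leq_trans (size_polyMleq _ _)) // size_polyX addn2 /= ltnS IH.
rewrite mul_polyC; apply: leq_trans (size_scale_leq _ _) _.
by case: ifP => _; rewrite ?size_poly0 // ltnW // ltnS IH.
Qed.

Lemma eval2_linear_exp n (T : {poly R} -> {poly R}) (a : R) z w :
  linear_on n T ->
  eval2 (extT T (('X%:P + a%:P *: 'X) ^+ n)) z w =
  (cxT n T (('X + (rc a * w)%:P) ^+ n)).[z].
Proof.
move=> hT; rewrite (eval2_extT hT) => [|i]; last exact: size_coef_linear_exp.
congr ((cxT n T _).[z]).
rewrite rmorphXn horner_exp rmorphD /= map_polyC /= map_polyX map_polyZ /=.
by rewrite map_polyX map_polyC hornerD hornerC hornerZ hornerX polyCM.
Qed.

Lemma eval2_symbol n (T : {poly R} -> {poly R}) z w : linear_on n T ->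
  eval2 (extT T (('X%:P + 'X) ^+ n)) z w = (cxT n T (('X + w%:P) ^+ n)).[z].
Proof.
move=> hT; have := eval2_linear_exp 1 z w hT.
by rewrite polyC1 scale1r rmorph1 mul1r.
Qed.

Lemma eval2_symbolN n (T : {poly R} -> {poly R}) z w : linear_on n T ->
  eval2 (extT T (('X%:P - 'X) ^+ n)) z w = (cxT n T (('X + (- w)%:P) ^+ n)).[z].
Proof.
move=> hT; have := eval2_linear_exp (-1) z w hT.
by rewrite polyCN polyC1 scaleN1r rmorphN1 mulN1r.
Qed.

Lemma size_comp_polyNX (f : {poly R}) : size (f \Po (- 'X)) = size f.
Proof. by rewrite size_comp_poly2 // size_polyN size_polyX. Qed.

Lemma linear_on_compN n (T : {poly R} -> {poly R}) : linear_on n T ->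
  linear_on n (fun f => T (f \Po (- 'X))).
Proof.
move=> hT c f g sf sg; rewrite comp_polyD comp_polyZ hT //;
  by rewrite size_comp_polyNX.
Qed.

(** This is (-X + w)^n = (-1)^n (X - w)^n, compared monomial by monomial. *)
Lemma cxT_compN n (T : {poly R} -> {poly R}) (w : C) : linear_on n T ->
  cxT n (fun f => T (f \Po (- 'X))) (('X + w%:P) ^+ n) =
  (-1) ^+ n *: cxT n T (('X + (- w)%:P) ^+ n).
Proof.
move=> hT; rewrite /cxT scaler_sumr; apply: eq_bigr => i _ /=.
have -> : 'X^i \Po (- 'X) = ((-1) ^+ i : R) *: 'X^i.
  by rewrite comp_Xn_poly [LHS]exprNn -mul_polyC polyC_exp polyCN polyC1.
rewrite scalerA.
rewrite (linear_onZ hT) ?size_polyXn // map_polyZ scalerA /=; congr (_ *: _).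
have li : (i <= n)%N by rewrite -ltnS.
rewrite !coef_XaddC_exp // [(- w) ^+ _]exprNn -mulrnAr mulrA.
have -> : (-1) ^+ n = (-1) ^+ i * (-1) ^+ (n - i) :> C by rewrite -exprD subnKC.
rewrite -[(-1) ^+ i * _ * _]mulrA -expr2 -exprM mulnC exprM sqrrN !expr1n mulr1.
by rewrite rmorphXn rmorphN1 mulrC.
Qed.

Lemma preserves_compN n (T : {poly R} -> {poly R}) :
  preserves_hyperbolicity n (fun f => T (f \Po (- 'X))) ->
  preserves_hyperbolicity n T.
Proof.
move=> h f sf hf; have := h (f \Po (- 'X)); rewrite size_comp_polyNX => /(_ sf).
rewrite -comp_polyA -[(- 'X) \Po _]/(comp_poly _ _) raddfN /= comp_polyX opprK comp_polyXr.
apply; case: hf => f0 hf; split.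
  by rewrite -size_poly_eq0 size_comp_polyNX size_poly_eq0.
move=> z; rewrite RtoC_rc /root.
rewrite map_comp_poly rmorphN /= map_polyX horner_comp hornerN hornerX => hz.
by apply: oppr_inj; rewrite oppr0 -cImN; apply: hf.
Qed.

Lemma stable_symbol_preserves n (T : {poly R} -> {poly R}) : linear_on n T ->
  real_stable2 (extT T (('X%:P + 'X) ^+ n)) -> preserves_hyperbolicity n T.
Proof.
move=> hT [_ h]; apply: symbol_preserves => // z w Iz Iw.
by rewrite -eval2_symbol // h.
Qed.

Lemma stable_symbolN_preserves n (T : {poly R} -> {poly R}) : linear_on n T ->
  real_stable2 (extT T (('X%:P - 'X) ^+ n)) -> preserves_hyperbolicity n T.
Proof.
move=> hT [_ h]; apply: preserves_compN.
apply: symbol_preserves; first exact: linear_on_compN.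
move=> z w Iz Iw; rewrite cxT_compN // hornerZ mulf_neq0 ?signr_eq0 //.
by rewrite -eval2_symbolN // h.
Qed.

(** * Interlacing *)

(** Inverse of [interleave]: the entries of c at alternate positions, with the two lists exchanging
    roles at each step. An interlacing pair is thus encoded by one sorted list. *)
Fixpoint evod (c : seq R) : seq R * seq R :=
  if c is x :: c' then (x :: (evod c').2, (evod c').1) else ([::], [::]).

Lemma evod_ind (P : seq R -> Prop) : P [::] -> (forall x, P [:: x]) ->
  (forall x y c, P c -> P (x :: y :: c)) -> forall c, P c.
Proof.
move=> P0 P1 P2 c.
suff [] : P c /\ forall x, P (x :: c) by [].
by elim: c => [|y c [IH1 IH2]]; split=> // x; apply: P2.
Qed.

Lemma evodK c : interleave (evod c).1 (evod c).2 = c.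
Proof. by elim/evod_ind: c => //= x y c ->. Qed.

Lemma interleaveK (a b : seq R) : size b = size a \/ (size b).+1 = size a ->
  evod (interleave a b) = (a, b).
Proof.
elim: a b => [|x a IH] [|y b] //=; try by case.
  by case=> // -[]; case: a {IH}.
by move=> h; rewrite IH //; case: h => -[]; [left|right].
Qed.

Definition prodX (s : seq R) : {poly R} := \prod_(x <- s) ('X - x%:P).

Lemma prodX_cons x s : prodX (x :: s) = ('X - x%:P) * prodX s.
Proof. exact: big_cons. Qed.

Definition pev c := prodX (evod c).1.
Definition pod c := prodX (evod c).2.

Lemma pev_cons x c : pev (x :: c) = ('X - x%:P) * pod c.
Proof. exact: prodX_cons. Qed.
Lemma pod_cons x c : pod (x :: c) = pev c. Proof. by []. Qed.

Definition cev (p : {poly R}) (z : C) := (map_poly rc p).[z].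

Lemma cevM p q z : cev (p * q) z = cev p z * cev q z.
Proof. by rewrite /cev rmorphM hornerM. Qed.
Lemma cevD p q z : cev (p + q) z = cev p z + cev q z.
Proof. by rewrite /cev rmorphD hornerD. Qed.
Lemma cevZ k p z : cev (k *: p) z = rc k * cev p z.
Proof. by rewrite /cev map_polyZ hornerZ. Qed.
Lemma cev_XsubC x z : cev ('X - x%:P) z = z - rc x.
Proof. by rewrite /cev rmorphB /= map_polyX map_polyC /= hornerXsubC. Qed.

(* Its argument is the alternating sum of the increasing arguments of the z - x,
   for x in c. *)
Definition alt c z := cev (pev c) z * conjc (cev (pod c) z).

Lemma alt_cons x c z : alt (x :: c) z = (z - rc x) * conjc (alt c z).
Proof.
by rewrite /alt pev_cons pod_cons cevM cev_XsubC [conjc (_ * _)]rmorphM /= conjcK; ring.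
Qed.

(** The second conjunct says that the argument of [alt] is at least that of z - x; it carries the
    induction and gives the even case. *)
Lemma alt_odd x c z : 0 < complex.Im z -> sorted <=%R (x :: c) -> ~~ odd (size c) ->
  0 < complex.Im (alt (x :: c) z) /\
  0 <= complex.Im (alt (x :: c) z * conjc (z - rc x)).
Proof.
move=> Iz; elim/evod_ind: c x => [|y|y t c IH] x //=.
  move=> _ _; have -> : alt [:: x] z = z - rc x.
    by rewrite alt_cons /alt /pev /pod /prodX /= !big_nil /cev rmorph1 hornerE
      rmorph1 !mulr1 ?conjc1 ?mulr1.
  by rewrite !reimE /=; split; nra.
move=> /and3P[xy yt ct]; rewrite negbK => sc.
have [v0 v1] := IH t ct sc.
rewrite alt_cons (alt_cons y) [conjc (_ * _)]rmorphM /= conjcK.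
move: (alt _ _) v0 v1 => v; rewrite !reimE /= => v0 v1.
set a := complex.Re v in v1 *; set b := complex.Im v in v0 v1 *.
set X := complex.Re z in v1 *; set Y := complex.Im z in Iz v1 *.
(* The second conjunct survives the replacement of t by the smaller y, because b > 0. *)
have g0 : 0 <= b * (X - y) - a * Y by nra.
have n0 : 0 < (X - y) ^+ 2 + Y ^+ 2 by rewrite ltr_wpDl ?sqr_ge0 // exprn_gt0.
split.
  rewrite [ltRHS](_ : _ = ((X - y) ^+ 2 + Y ^+ 2) * b +
    (y - x) * (b * (X - y) - a * Y)); last by ring.
  by apply: ltr_wpDr; [rewrite mulr_ge0 // subr_ge0|rewrite mulr_gt0].
rewrite [leRHS](_ : _ = ((X - x) ^+ 2 + Y ^+ 2) * (b * (X - y) - a * Y)); last by ring.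
by rewrite mulr_ge0 // addr_ge0 ?sqr_ge0.
Qed.

(** The argument of z - x is strictly below that of z - y, which is at most the argument of
    [alt (y :: c) z]. *)
Lemma alt_even x y c z : 0 < complex.Im z -> x < y -> sorted <=%R (y :: c) ->
  ~~ odd (size c) -> complex.Im (alt [:: x, y & c] z) < 0.
Proof.
move=> Iz xy cs sc; have [v0 v1] := alt_odd Iz cs sc.
rewrite alt_cons; move: (alt _ _) v0 v1 => v; rewrite !reimE /=; nra.
Qed.

(** Up to sign, Im (a conj(b)) is the determinant of a and b as vectors of the real plane. *)
Lemma real_comb_eq0 (a b : C) (k l : R) : complex.Im (a * conjc b) != 0 ->
  rc k * a + rc l * b = 0 -> k = 0 /\ l = 0.
Proof.
move=> /eqP hI h.
have := congr1 (@complex.Re R) h; have := congr1 (@complex.Im R) h.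
move: hI; rewrite !reimE /=.
move: (complex.Re a) (complex.Im a) (complex.Re b) (complex.Im b) => p q r s hI h1 h2.
have h1' : k * q + l * s = 0 by rewrite -[RHS]h1; ring.
have h2' : k * p + l * r = 0 by rewrite -[RHS]h2; ring.
have ek : k * (p * - s + q * r) = 0.
  have -> : k * (p * - s + q * r) = (k * q + l * s) * r - (k * p + l * r) * s by ring.
  by rewrite h1' h2' !mul0r subr0.
have el : l * (p * - s + q * r) = 0.
  have -> : l * (p * - s + q * r) = (k * p + l * r) * q - (k * q + l * s) * p by ring.
  by rewrite h1' h2' !mul0r subr0.
by split; apply/eqP; [move/eqP: ek|move/eqP: el];
  rewrite mulf_eq0 => /orP[//|/eqP /hI].
Qed.

Lemma evod_comb_hyperbolic c (k l : R) : sorted <=%R c ->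
  let p := k *: pev c + l *: pod c in hyperbolic p \/ p = 0.
Proof.
move=> sc p; case: (eqVneq p 0) => [|p0]; [by right|left].
apply: hyperbolic_nouhp => //.
have kl0 : ~ (k = 0 /\ l = 0).
  by case=> k0 l0; move: p0; rewrite /p k0 l0 !scale0r addr0 eqxx.
case: c sc @p p0 => [|x c] sc p p0.
  move=> z _; move: p0; rewrite /p /pev /pod /prodX /= !big_nil -scalerDl.
  rewrite scaler_eq0 oner_eq0 orbF => kl.
  by rewrite -[(map_poly _ _).[z]]/(cev _ _) cevZ /cev rmorph1 hornerE mulr1 fmorph_eq0.
case: (boolP (odd (size c))) => oc; last first.
  move=> z Iz; have [v0 _] := alt_odd Iz sc oc.
  apply/eqP => hz; apply: kl0; apply: (@real_comb_eq0 _ _ _ _ (lt0r_neq0 v0)).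
  by rewrite -!cevZ -cevD.
case: c sc oc @p p0 => [//|y c] /andP[xy yc] oc p p0.
(* [alt_even] needs x < y. Lowering the first zero x to x - e makes this strict, and Hurwitz's
   theorem brings e back to 0. *)
pose F e := map_poly rc (p + (e * k) *: pod (y :: c)).
have [|||F0|nu] := @hurwitz R F (maxn (size (map_poly rc p)) (size (map_poly rc (pod (y :: c))))).
- move=> e; rewrite /F rmorphD /= map_polyZ /=.
  apply: leq_trans (size_polyD _ _) _; rewrite geq_max leq_maxl /=.
  by apply: leq_trans (size_scale_leq _ _) _; rewrite leq_maxr.
- move=> z; exists ((cev p z)%:P + (rc k * cev (pod (y :: c)) z) *: 'X) => e.
  rewrite -[(F e).[z]]/(cev _ _) cevD cevZ !hornerE rmorphM; ring.
- move=> e e0 e1 z Iz.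
  have xey : x - e < y by lra.
  have v0 := alt_even Iz xey yc oc.
  apply/eqP => hz; apply: kl0; apply: (@real_comb_eq0 _ _ _ _ (ltr0_neq0 v0)).
  rewrite -!cevZ -cevD -hz; congr (_.[z]); congr (map_poly _ _).
  rewrite /p !pev_cons polyCB opprB addrA -!mul_polyC polyCM; ring.
- by move: F0; rewrite /F mul0r scale0r addr0 => /eqP; rewrite map_poly_eq0 (negbTE p0).
- by move: nu; rewrite /F mul0r scale0r addr0.
Qed.

Lemma interlace_comb_hyperbolic (P Q : {poly R}) (k l : R) : zeros_interlace P Q ->
  hyperbolic (k *: P + l *: Q) \/ k *: P + l *: Q = 0.
Proof.
move=> [a [b [[_ DP] [[_ DQ] ab]]]]; rewrite DP DQ !scalerA.
case: ab => -[sab so]; last rewrite addrC.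
  by have := evod_comb_hyperbolic _ _ so; rewrite /pev /pod interleaveK //; apply.
by have := evod_comb_hyperbolic _ _ so; rewrite /pev /pod interleaveK //; apply.
Qed.

End Sufficiency.

(** * Sign alternation and perturbation *)

Section Alternation.
Variable R : realType.
Local Notation C := (complex R).
Local Notation rc := (real_complex R).

Definition alternates (h : {poly R}) (x y : R) := (y < x) && (h.[x] * h.[y] < 0).

Lemma alternates_roots (h : {poly R}) y0 s : path (alternates h) y0 s ->
  exists r, [/\ size r = size s, uniq r, all (root h) r & all (fun x => x < y0) r].
Proof.
elim: s y0 => [|y s IH] y0 /=; first by exists [::].
move=> /andP[/andP[yy hy] /IH [r [sr ur rr lr]]].
have [x] := poly_ivtoo (ltW yy) (etrans (congr1 (fun t => t < 0) (mulrC _ _)) hy).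
rewrite in_itv /= => /andP[yx xy0] rx; exists (x :: r); split=> /=.
- by rewrite sr.
- by rewrite ur andbT; apply/negP => /(allP lr); rewrite ltNge (ltW yx).
- by rewrite rx.
- rewrite xy0; apply/allP => t /(allP lr) ty; exact: lt_trans ty yy.
Qed.

(** The degree may exceed the number of sign changes by one: after division by the roots found, a
    real polynomial of degree at most one remains. *)
Lemma alternates_hyperbolic (h : {poly R}) y0 s : path (alternates h) y0 s ->
  (size h <= (size s).+2)%N -> hyperbolic h \/ h = 0.
Proof.
move=> /alternates_roots [r [sr ur rr _]] sh.
case: (eqVneq h 0) => [|h0]; [by right|left].
have : prodX r %| h by apply: uniq_roots_dvdp; rewrite ?uniq_rootsE.
case/dvdpP => q Dq; have q0 : q != 0 by apply: contra_neq h0 => q0; rewrite Dq q0 mul0r.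
have sq : (size q <= 2)%N.
  move: sh; rewrite Dq size_Mmonic ?monic_prod_XsubC // size_prod_XsubC addnS /= sr.
  by rewrite -[in (_ <= (size s).+2)%N]add2n leq_add2r.
split=> // z; rewrite RtoC_rc Dq rmorphM rootM => /orP[|].
  rewrite /root (horner_coef_wide _ (leq_trans (size_poly _ _) sq)).
  rewrite !big_ord_recl big_ord0 /= addr0 expr0 mulr1 expr1 !coef_map /=.
  move=> /eqP hz; have := congr1 (@complex.Im R) hz; rewrite !reimE /=.
  rewrite /bump /= mul0r addr0 add0r => /eqP; rewrite mulf_eq0 => /orP[/eqP q1|/eqP //].
  have := congr1 (@complex.Re R) hz; rewrite !reimE /= /bump /= q1 !mul0r subr0 addr0 => q00.
  move: q0; rewrite -size_poly_gt0 => /negP; case; rewrite size_poly_gt0.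
  by apply/negP; rewrite negbK; apply/eqP/polyP => -[|[|i]];
    rewrite coef0 // nth_default // (leq_trans sq).
have [_] := split_hyperbolic r (oner_neq0 R).
by rewrite scale1r; apply.
Qed.

Lemma prodX_gt0 (r : seq R) y : all (fun x => x < y) r -> 0 < (prodX r).[y].
Proof.
elim: r => [|x r IH] /=; first by rewrite /prodX big_nil hornerC ltr01.
by case/andP => xy /IH h; rewrite prodX_cons hornerM hornerXsubC mulr_gt0 ?subr_gt0.
Qed.

(** The bound M carries the induction: the points chosen for the smaller roots stay below the
    largest root x, so the factor X - x keeps their alternation, and one point above x adds a sign
    change. *)
Lemma alternates_prodX (r : seq R) M : sorted (fun x y => y < x) r ->
  all (fun x => x < M) r -> exists y0 s, [/\ size s = size r,
    all (fun y => y < M) (y0 :: s), all (fun x => x < y0) r &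
    path (alternates (prodX r)) y0 s].
Proof.
elim: r M => [|x r IH] M.
  by exists (M - 1), [::]; split=> //=; rewrite andbT ltrBlDr ltrDl.
move=> /= xr /andP[xM rM].
have gt_trans : transitive (fun x y : R => y < x) by move=> a b c ab bc; apply: lt_trans bc ab.
have rx : all (fun y => y < x) r by apply: order_path_min xr.
have [y0 [s [ss sM ry sp]]] := IH x (path_sorted xr) rx.
have xm : x < (x + M) / 2 by lra.
have mM : (x + M) / 2 < M by lra.
exists ((x + M) / 2), (y0 :: s); split.
- by rewrite /= ss.
- apply/andP; split=> //; apply/allP => t /(allP sM) h.
  exact: lt_trans h xM.
- by rewrite /= xm /=; apply/allP => t /(allP rx) h; apply: lt_trans xm.
have y0x : y0 < x by case/andP: sM.
rewrite /= {1}/alternates (lt_trans y0x xm) !prodX_cons !hornerM !hornerXsubC /=.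
apply/andP; split.
  have h1 : 0 < (prodX r).[(x + M) / 2].
    by apply: prodX_gt0; apply/allP => t /(allP rx) h; apply: lt_trans xm.
  have h2 := prodX_gt0 ry.
  rewrite mulrACA pmulr_llt0 ?mulr_gt0 // nmulr_llt0; last by rewrite subr_lt0.
  by rewrite subr_gt0.
apply: (sub_in_path _ sM sp) => u v ux vx; rewrite /alternates => /andP[-> h] /=.
rewrite !hornerM !hornerXsubC mulrACA pmulr_rlt0 // nmulr_rgt0.
  by rewrite subr_lt0.
by rewrite subr_lt0.
Qed.

Lemma alternates_perturb (f g : {poly R}) y0 s : path (alternates f) y0 s ->
  exists2 d, 0 < d & forall e, 0 < e -> e <= d ->
    path (alternates (f + e *: g)) y0 s.
Proof.
elim: s y0 => [|y s IH] y0 /=; first by exists 1.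
move=> /andP[/andP[yy hy] /IH [d d0 hd]].
pose F := f.[y0] * f.[y]; pose H := g.[y0] * g.[y].
pose G := f.[y0] * g.[y] + g.[y0] * f.[y].
have D0 : 0 < 1 + `|G| + `|H| - F.
  by have := normr_ge0 G; have := normr_ge0 H; rewrite -/F in hy; lra.
(* For 0 < e <= d' this gives e <= 1 and e (|G| + |H|) < -F, hence F + e G + e^2 H < 0. *)
pose d' := - F / (1 + `|G| + `|H| - F).
have d'0 : 0 < d' by rewrite divr_gt0 // oppr_gt0.
exists (Num.min d d') => [|e e0]; first by rewrite lt_min d0.
rewrite le_min => /andP[ed ed']; rewrite hd // andbT /alternates yy /=.
rewrite !hornerD !hornerZ.
rewrite [X in X < 0](_ : _ = F + e * (G + e * H)); last by rewrite /F /G /H; ring.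
move: ed'; rewrite /d' ler_pdivlMr // => h.
have F0 : F < 0 by [].
have e1 : e <= 1 by have := normr_ge0 G; have := normr_ge0 H; nra.
have h1 : G <= `|G| := ler_norm _.
have h2 : H <= `|H| := ler_norm _.
have h3 : e * H <= `|H|.
  by apply: le_trans (ler_wpM2l (ltW e0) h2) _; rewrite ler_piMl.
have h4 : e * (G + e * H) <= e * (`|G| + `|H|) by rewrite ler_pM2l // lerD.
nra.
Qed.

Lemma uniq_simple_roots (s : seq R) :
  (forall x, x \in s -> (prodX s)^`().[x] != 0) -> uniq s.
Proof.
elim: s => //= x s IH h.
have e y : (prodX (x :: s))^`().[y] = (prodX s).[y] + (y - x) * (prodX s)^`().[y].
  by rewrite prodX_cons derivM derivXsubC mul1r hornerD hornerM hornerXsubC.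
apply/andP; split.
  have := h x (mem_head _ _); rewrite e subrr mul0r addr0.
  by apply: contra => xs; rewrite -[_ == 0]/(root _ _) root_prod_XsubC.
apply: IH => y ys; have := h y; rewrite inE ys orbT e => /(_ isT).
have -> : (prodX s).[y] = 0 by apply/rootP; rewrite root_prod_XsubC.
by rewrite add0r; apply: contra => /eqP ->; rewrite mulr0.
Qed.

(** The degree of f is at least n-1, so its simple zeros give at least n-1 sign changes; these
    survive a small perturbation and suffice in degree at most n. *)
Lemma simple_perturb n (f g : {poly R}) : hyperbolic f ->
  (forall x, f.[x] = 0 -> f^`().[x] != 0) -> (n <= size f)%N ->
  (size f <= n.+1)%N -> (size g <= n.+1)%N ->
  exists2 e, e != 0 & hyperbolic (f + e *: g) \/ f + e *: g = 0.
Proof.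
move=> hf hs nf fn gn; have [f0 _] := hf; have [s Df] := hyperbolic_split hf.
have l0 : lead_coef f != 0 by rewrite lead_coef_eq0.
have us : uniq s.
  apply: uniq_simple_roots => x xs.
  have /hs : f.[x] = 0.
    by rewrite Df hornerZ (rootP (_ : root _ x)) ?mulr0 // root_prod_XsubC.
  by rewrite {1}Df derivZ hornerZ mulf_eq0 (negbTE l0).
pose r := rev (sort <=%R s).
have pr : perm_eq r s by rewrite perm_rev perm_sort.
have Df' : f = lead_coef f *: prodX r by rewrite {1}Df /prodX (perm_big _ pr).
have sr : sorted (fun x y => y < x) r.
  by rewrite /r rev_sorted lt_sorted_uniq_le sort_uniq us sort_le_sorted.
have [M hM] : exists M, all (fun x => x < M) r.
  elim: (r) => [|x t [M hM]]; first by exists 0.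
  exists (Num.max M (x + 1)); rewrite /= lt_max ltrDl ltr01 orbT /=.
  by apply/allP => y /(allP hM) h; rewrite lt_max h.
have [y0 [t [st _ _ pt]]] := alternates_prodX sr hM.
have pf : path (alternates f) y0 t.
  apply: sub_path pt => x y; rewrite /alternates => /andP[-> h] /=.
  by rewrite Df' !hornerZ mulrACA pmulr_rlt0 // -expr2 exprn_even_gt0.
have [d d0 hd] := alternates_perturb g pf.
exists d; first by rewrite gt_eqF.
apply: (alternates_hyperbolic (hd d d0 (lexx d))).
apply: leq_trans (size_polyD _ _) _.
have ns : (n.+1 <= (size t).+2)%N.
  rewrite st (perm_size pr) ltnS; apply: leq_trans nf _.
  by rewrite Df size_scale // size_prod_XsubC.
rewrite geq_max (leq_trans fn ns) /=.
by apply: leq_trans (size_scale_leq _ _) (leq_trans gn ns).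
Qed.

End Alternation.

(** * The real polynomials 2 Re (c (x+w)^n) *)

Section RealPart.
Variable R : realType.
Local Notation C := (complex R).
Local Notation rc := (real_complex R).

Definition two_re (p : {poly C}) : {poly R} :=
  map_poly (fun v => 2 * complex.Re v) p.

Lemma two_reE p : map_poly rc (two_re p) = p + map_poly (@conjc R) p.
Proof.
apply/polyP => i; rewrite coef_map coef_map_id0 ?mulr0 // coefD coef_map /=.
by apply: complex_ext; rewrite !reimE /=; ring.
Qed.

Variables (n : nat) (c w : C).
Hypotheses (c0 : c != 0) (Iw : 0 < complex.Im w).

Definition half_power_re : {poly R} := two_re (c *: ('X + w%:P) ^+ n).
Local Notation f := half_power_re.

Lemma half_power_reE : map_poly rc f =
  c *: ('X + w%:P) ^+ n + conjc c *: ('X + (conjc w)%:P) ^+ n.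
Proof.
rewrite two_reE map_polyZ /= rmorphXn /= rmorphD /= map_polyX map_polyC //.
Qed.

Lemma half_power_re_size : (size f <= n.+1)%N.
Proof.
apply: leq_trans (size_poly _ _) _; apply: leq_trans (size_scale_leq _ _) _.
by rewrite -[w%:P]opprK -polyCN size_exp_XsubC.
Qed.

Lemma half_power_re_neq0 : (0 < n)%N -> f != 0.
Proof.
move=> n0; apply/eqP => h; have := half_power_reE; rewrite h rmorph0.
move/(congr1 (fun p => p.[- w])); rewrite horner0 !hornerE.
rewrite addNr expr0n eqn0Ngt n0 mulr0 add0r => /esym/eqP.
rewrite mulf_eq0 conjc_eq0 (negbTE c0) /= expf_eq0 n0 /= => /eqP h2.
have := congr1 (@complex.Im R) h2; rewrite !reimE => h3.
by move: Iw; rewrite (_ : complex.Im w = 0) ?ltxx //; lra.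
Qed.

(** At a zero z the two conjugate terms have equal modulus, so z is equidistant from -w and
    -conj(w), hence real. *)
Lemma half_power_re_hyperbolic : (0 < n)%N -> hyperbolic f.
Proof.
move=> n0; split; first exact: half_power_re_neq0.
move=> z; rewrite RtoC_rc half_power_reE /root !hornerE /= => /eqP hz.
have e : `|z + w| = `|z + conjc w|.
  apply/eqP; rewrite -(@eqrXn2 _ n) // -!normrX.
  have : `|c * (z + w) ^+ n| = `|conjc c * (z + conjc w) ^+ n|.
    by rewrite -[in RHS]normrN; congr `|_|; apply/eqP; rewrite -subr_eq0 opprK hz.
  by rewrite !normrM normcJ => /mulfI -> //; rewrite normr_eq0.
have h : `|z + w| <= `|z + conjc w| by rewrite e.
have h' : `|z + conjc w| <= `|z + w| by rewrite e.
move: h h'; rewrite !normc_leE !reimE => h h'.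
have /eqP : complex.Im z * complex.Im w = 0 by clear -h h'; lra.
by rewrite mulf_eq0 (gt_eqF Iw) orbF => /eqP.
Qed.

(** With u = x + w and v = conj(u), eliminating conj(c) v^(n-1) between f(x) = 0 and f'(x) = 0
    leaves c u^(n-1) (u - v) = 0, although u is not real. *)
Lemma half_power_re_simple : (0 < n)%N -> forall x, f.[x] = 0 -> f^`().[x] != 0.
Proof.
move=> n0 x hx; apply/negP => /eqP hx'.
have e1 : (map_poly rc f).[rc x] = 0 by rewrite hornerRC hx.
have e2 : (map_poly rc f)^`().[rc x] = 0 by rewrite deriv_map hornerRC hx'.
have hd (v t : C) : (('X + v%:P) ^+ n)^`().[t] = (t + v) ^+ n.-1 * n%:R.
  by rewrite deriv_exp derivD derivX derivC addr0 mul1r hornerMn !hornerE mulr_natr.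
move: e1 e2; rewrite half_power_reE derivD !derivZ hornerD !hornerZ !hd !hornerE.
set u := rc x + w; set v := rc x + conjc w; rewrite -(prednK n0) !exprS /=.
set A := c * (_ * _) => e1; rewrite -mulrDl => /eqP.
rewrite mulf_eq0 pnatr_eq0 /= orbF => /eqP e2.
have Iu : complex.Im u = complex.Im w by rewrite /u !reimE /= add0r.
have vu : v = conjc u by rewrite /v /u rmorphD /= oppr0.
have u0 : u != 0 by apply: contraTneq Iw => h; rewrite -Iu h ltxx.
have : c * u ^+ n.-1 * (u - v) = 0.
  have -> : c * u ^+ n.-1 * (u - v) = A + conjc c * (v * v ^+ n.-1)
     - v * (c * u ^+ n.-1 + conjc c * v ^+ n.-1) by rewrite /A; ring.
  by rewrite e1 e2 mulr0 subr0.
move/eqP; rewrite !mulf_eq0 (negbTE c0) (negbTE (expf_neq0 _ u0)) /= => /eqP uv.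
have := congr1 (@complex.Im R) uv; rewrite vu !reimE /= add0r => h3.
by move: Iw; rewrite (_ : complex.Im w = 0) ?ltxx //; lra.
Qed.

(** The two top coefficients are 2 Re c and 2 n Re (c w); if both vanish then c = 0, since Im w >
    0. *)
Lemma half_power_re_size_ge : (n <= size f)%N.
Proof.
case: (posnP n) => [-> //|n0]; rewrite leqNgt; apply/negP => sf.
have co i : (i <= n)%N -> f`_i = 2 * complex.Re (c * (w ^+ (n - i) *+ 'C(n, i))).
  by move=> li; rewrite coef_map_id0 ?mulr0 // coefZ coef_XaddC_exp.
have h1 := co n (leqnn _); have h2 := co n.-1 (leq_pred _).
move: h1 h2; rewrite !nth_default //; last 2 first.
- by rewrite -ltnS prednK.
- exact: ltnW.
rewrite subnn expr0 binn mulr1n mulr1 => h1.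
have bn : 'C(n, n.-1) = n by rewrite -{1}(prednK n0) binSn prednK.
have hn v m : complex.Re (c * (v *+ m)) = complex.Re (c * v) * m%:R.
  elim: m => [|m IH]; first by rewrite !mulr0n mulr0 mulr0.
  by rewrite !mulrS mulrDr cReD IH; ring.
rewrite -subn1 subKn // expr1 subn1 bn hn cReM => h2.
have rc0 : complex.Re c = 0 by lra.
have nn : (0 : R) < n%:R by rewrite ltr0n.
have ic0 : complex.Im c = 0.
  apply/eqP; move/eqP: h2; rewrite rc0 mul0r sub0r eq_sym !mulf_eq0 oppr_eq0.
  by rewrite !mulf_eq0 (gt_eqF nn) (gt_eqF Iw) pnatr_eq0 /= ?orbF.
by move: c0; rewrite (_ : c = 0) ?eqxx //; apply: complex_ext.
Qed.

End RealPart.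

(** * Obreschkoff's theorem *)

Section PolyFun.
Variable R : realType.
Local Notation C := (complex R).
Local Notation rc := (real_complex R).

Lemma conj_rc (t : R) : conjc (rc t) = rc t.
Proof. by apply: complex_ext; rewrite //= oppr0. Qed.

(** As t is real, this class is closed under conjugation. Imaginary parts are then real polynomials
    in t, for which the intermediate value theorem replaces topological arguments. *)
Definition polyfun (F : R -> C) := exists G : {poly C}, forall t, F t = G.[rc t].

Lemma pf_const a : polyfun (fun=> a).
Proof. by exists a%:P => t; rewrite hornerC. Qed.
Lemma pf_id : polyfun (fun t => rc t).
Proof. by exists 'X => t; rewrite hornerX. Qed.
Lemma pf_add F G : polyfun F -> polyfun G -> polyfun (fun t => F t + G t).
Proof. by move=> [p hp] [q hq]; exists (p + q) => t; rewrite hornerD hp hq. Qed.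
Lemma pf_mul F G : polyfun F -> polyfun G -> polyfun (fun t => F t * G t).
Proof. by move=> [p hp] [q hq]; exists (p * q) => t; rewrite hornerM hp hq. Qed.
Lemma pf_opp F : polyfun F -> polyfun (fun t => - F t).
Proof. by move=> [p hp]; exists (- p) => t; rewrite hornerN hp. Qed.
Lemma pf_exp F n : polyfun F -> polyfun (fun t => F t ^+ n).
Proof. by move=> [p hp]; exists (p ^+ n) => t; rewrite horner_exp hp. Qed.
Lemma pf_conj F : polyfun F -> polyfun (fun t => conjc (F t)).
Proof.
move=> [p hp]; exists (map_poly (@conjc R) p) => t.
by rewrite -{1}(conj_rc t) (horner_map (@conjc R)) hp.
Qed.
Lemma pf_sum n (F : 'I_n -> R -> C) : (forall i, polyfun (F i)) ->
  polyfun (fun t => \sum_(i < n) F i t).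
Proof.
elim: n F => [|n IH] F hF.
  by exists 0 => t; rewrite big_ord0 horner0.
have [p hp] := pf_add (hF ord0) (IH (fun i => F (lift ord0 i)) (fun i => hF _)).
by exists p => t; rewrite big_ord_recl hp.
Qed.
Lemma pf_horner (p : {poly C}) F : polyfun F -> polyfun (fun t => p.[F t]).
Proof.
move=> hF; have [q hq] : polyfun (fun t => \sum_(i < size p) p`_i * F t ^+ i).
  by apply: pf_sum => i; apply: pf_mul; [apply: pf_const|apply: pf_exp].
by exists q => t; rewrite horner_coef hq.
Qed.

Lemma pf_im F : polyfun F -> exists q : {poly R}, forall t, complex.Im (F t) = q.[t].
Proof.
move=> [p hp]; exists (map_poly (@complex.Im R) p) => t; rewrite hp.
elim/poly_ind: p {hp} => [|p c IH].
  by rewrite horner0 map_poly0 horner0.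
have -> : map_poly (@complex.Im R) (p * 'X + c%:P) =
    map_poly (@complex.Im R) p * 'X + (complex.Im c)%:P.
  apply/polyP => i; rewrite coefD coefMX coefC coef_map_id0 // coefD coefMX coefC.
  by case: i => [|i] /=; rewrite cImD ?coef_map_id0.
by rewrite !hornerE cImD cImM IH /= mulr0 add0r.
Qed.

Lemma im_same_sign F : polyfun F ->
  (forall t, 0 <= t -> t <= 1 -> complex.Im (F t) != 0) ->
  0 < complex.Im (F 0) -> 0 < complex.Im (F 1).
Proof.
move=> /pf_im [q hq] h; rewrite ltNge => h0; rewrite ltNge; apply/negP => h1.
have [||t] := @poly_ivt R (- q) 0 1; first exact: ler01.
  by rewrite !hornerN -!hq oppr_le0 oppr_ge0 h1 andbT ltW // ltNge.
by move=> /andP[t0 t1]; rewrite rootN => /rootP; rewrite -hq => /eqP; apply/negP/h.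
Qed.

(** A negative value at 0 would force a zero in (0,1]. *)
Lemma im_limit F k : polyfun F -> (forall t, 0 < t -> 0 < k * complex.Im (F t)) ->
  0 <= k * complex.Im (F 0).
Proof.
move=> /pf_im [q hq] h; rewrite leNgt; apply/negP; rewrite hq => h0.
have [||t] := @poly_ivt R (k *: q) 0 1; first exact: ler01.
  by rewrite !hornerZ (ltW h0) -hq ltW // h.
move=> /andP[t0 t1] /rootP; rewrite hornerZ => rt.
move: t0; rewrite le_eqVlt => /orP[/eqP t0|/h].
  by move: rt h0; rewrite -t0 => ->; rewrite ltxx.
by rewrite hq rt ltxx.
Qed.

Lemma segment_uhp (z0 z1 : C) t : 0 < complex.Im z0 -> 0 < complex.Im z1 ->
  0 <= t -> t <= 1 -> 0 < complex.Im (z0 + rc t * (z1 - z0)).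
Proof.
move=> I0 I1 t0 t1; rewrite !reimE /= !mul0r !addr0.
move: (complex.Im z0) (complex.Im z1) I0 I1 => a b a0 b0.
have [->|tn] := eqVneq t 1; first by lra.
have t1' : t < 1 by rewrite lt_def eq_sym tn.
have h1 : 0 < a * (1 - t) by rewrite mulr_gt0 // subr_gt0.
have h2 : 0 <= b * t by rewrite mulr_ge0 // ltW.
lra.
Qed.

Lemma pf_segment (z0 z1 : C) : polyfun (fun t => z0 + rc t * (z1 - z0)).
Proof. by apply: pf_add (pf_const _) _; apply: pf_mul; [exact: pf_id|exact: pf_const]. Qed.

End PolyFun.

(** * Interlacing from the sign of Im (P conj(Q)) *)

Section Obreschkoff.
Variable R : realType.
Local Notation C := (complex R).
Local Notation rc := (real_complex R).

(** Two adjacent copies of r are inserted: each parity class receives one, and the parity of every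
    other entry is kept. *)
Lemma evod_insert (c : seq R) r : sorted <=%R c ->
  exists c', [/\ sorted <=%R c', pev c' = ('X - r%:P) * pev c &
    pod c' = ('X - r%:P) * pod c].
Proof.
suff h (M : R) : M <= r -> path <=%R M c -> exists c', [/\ path <=%R M c',
    pev c' = ('X - r%:P) * pev c & pod c' = ('X - r%:P) * pod c].
  case: c h => [|x c] h sc.
    have [c' [pc e o]] := h r (lexx _) isT.
    by exists c'; split=> //; apply: path_sorted pc.
  have [||c' [pc e o]] := h (Num.min r x).
  - by rewrite ge_min lexx.
  - by rewrite /= ge_min lexx orbT.
  by exists c'; split=> //; apply: path_sorted pc.
elim: c M => [|x c IH] M Mr /=.
  move=> _; exists [:: r; r]; rewrite /= Mr lexx; split=> //.
    by rewrite !pev_cons pod_cons.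
  by rewrite pod_cons pev_cons.
move=> /andP[Mx xc]; case: (leP r x) => [rx|/ltW xr].
  exists [:: r, r, x & c]; rewrite /= Mr lexx rx xc; split=> //.
    by rewrite pev_cons.
  by rewrite pod_cons pev_cons.
have [c' [pc e o]] := IH x xr xc.
exists (x :: c'); rewrite /= Mx pc; split=> //.
  by rewrite !pev_cons o mulrCA.
Qed.

Definition between (b a : seq R) := forall a1 x y a2, a = a1 ++ x :: y :: a2 ->
  exists2 z, z \in b & (x <= z) && (z <= y).

(** The head of b comes strictly before the second entry of [x :: a], so after removal of x the
    hypotheses hold with the two lists exchanged. *)
Lemma between_evod_lt x (a b : seq R) : sorted <=%R (x :: a) -> sorted <=%R b ->
  all (fun y => x < y) b -> (forall y, y \in x :: a -> y \notin b) ->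
  between b (x :: a) -> between (x :: a) b ->
  exists2 c, sorted <=%R (x :: c) & evod (x :: c) = (x :: a, b).
Proof.
have [k] := ubnP (size a + size b); elim: k x a b => // k IH x a b.
case: b => [|y b] sk sa sb xb dis hab hba.
  case: a sk sa dis hab hba => [|x' a] sk sa dis hab hba; first by exists [::].
  by have [z] := hab [::] x x' a erefl.
have sa' : sorted <=%R a by apply: path_sorted sa.
have dis' z : z \in y :: b -> z \notin a.
  by move=> zb; apply/negP => za; have := dis z; rewrite inE za orbT zb => /(_ isT).
have xy : x < y by case/andP: xb.
have ya : all (fun z => y < z) a.
  case: a sk sa dis hab hba sa' dis' => [|x' a] //= sk sa dis hab hba sa' dis'.
  have [z zb /andP[xz zx']] := hab [::] x x' a erefl.
  have yz : y <= z.
    move: zb; rewrite inE => /orP[/eqP -> //|zb].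
    by have /allP := order_path_min le_trans sb; apply.
  have yx' : y < x'.
    rewrite lt_neqAle (le_trans yz zx') andbT; apply/negP => /eqP e.
    by have := dis' x'; rewrite -e mem_head in_cons e eqxx => /(_ isT).
  rewrite yx' /=; apply/allP => t ta; apply: lt_le_trans yx' _.
  by have /allP := order_path_min le_trans sa'; apply.
have [|||c sc ec] := IH y b a _ sb sa' ya dis'.
- by move: sk; rewrite /= addnS addnC.
- move=> b1 u v b2 eb; have [z] := hba _ _ _ _ eb.
  rewrite inE => /orP[/eqP ->|za uv]; last by exists z.
  move=> /andP[ux _]; have : u \in y :: b by rewrite eb mem_cat mem_head orbT.
  by move=> /(allP xb); rewrite ltNge ux.
- by move=> a1 u v a2 ea; apply: (hab (x :: a1) u v a2); rewrite ea.
exists (y :: c); first by rewrite /= (ltW xy).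
by rewrite /= in ec *; case: ec => -> ->.
Qed.

Lemma between_evod (a b : seq R) : sorted <=%R a -> sorted <=%R b ->
  (forall y, y \in a -> y \notin b) -> between b a -> between a b ->
  exists2 c, sorted <=%R c & evod c = (a, b) \/ evod c = (b, a).
Proof.
have dsym (a' b' : seq R) : (forall y, y \in a' -> y \notin b') ->
    forall y, y \in b' -> y \notin a'.
  by move=> h y yb; apply/negP => /h; rewrite yb.
have all_lt x y (t : seq R) : x < y -> sorted <=%R (y :: t) -> all (fun z => x < z) (y :: t).
  move=> xy st; rewrite /= xy /=; apply/allP => z zt; apply: lt_le_trans xy _.
  by have /allP := order_path_min le_trans st; apply.
case: a b => [|x a] [|y b] sa sb dis hab hba.
- by exists [::]; [|left].
- have [c sc ec] := between_evod_lt sb sa isT (dsym _ _ dis) hba hab.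
  by exists (y :: c); [|right].
- have [c sc ec] := between_evod_lt sa sb isT dis hab hba.
  by exists (x :: c); [|left].
case: (ltgtP x y) => xy.
- have [c sc ec] := between_evod_lt sa sb (all_lt _ _ _ xy sb) dis hab hba.
  by exists (x :: c); [|left].
- have [c sc ec] := between_evod_lt sb sa (all_lt _ _ _ xy sa) (dsym _ _ dis) hba hab.
  by exists (y :: c); [|right].
- by have := dis x (mem_head _ _); rewrite xy mem_head.
Qed.

Definition cross (p q : {poly R}) z := complex.Im (cev p z * conjc (cev q z)).

Lemma cross_swap p q z : cross q p z = - cross p q z.
Proof. by rewrite /cross !reimE; ring. Qed.

(** At r + t zeta the factor (X - r)^m contributes t^m zeta^m; divide by t^m > 0 and let t tend to
    0. *)
Lemma cross_local (p q p1 : {poly R}) (k r : R) m (zeta : C) :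
  (forall z, 0 < complex.Im z -> 0 < k * cross p q z) ->
  p = ('X - r%:P) ^+ m * p1 -> 0 < complex.Im zeta ->
  0 <= k * (complex.Im (zeta ^+ m) * (p1.[r] * q.[r])).
Proof.
move=> hk Dp Iz.
pose pt t := rc r + rc t * zeta.
pose F t := zeta ^+ m * (cev p1 (pt t) * conjc (cev q (pt t))).
have pfpt : polyfun pt.
  by apply: pf_add (pf_const _) _; apply: pf_mul (pf_id _) (pf_const _).
have pfF : polyfun F.
  apply: pf_mul (pf_const _) _; apply: pf_mul; first exact: pf_horner.
  by apply: pf_conj; apply: pf_horner.
have F0 : complex.Im (F 0) = complex.Im (zeta ^+ m) * (p1.[r] * q.[r]).
  rewrite /F /pt mul0r addr0 /cev !hornerRC conj_rc -rmorphM cImM /=.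
  by rewrite mulr0 add0r.
rewrite -F0; apply: im_limit => // t t0.
have tm : 0 < t ^+ m by apply: exprn_gt0.
have Ipt : 0 < complex.Im (pt t).
  by rewrite /pt !reimE /= add0r mul0r addr0 mulr_gt0.
have := hk _ Ipt; rewrite /cross.
have -> : cev p (pt t) * conjc (cev q (pt t)) = rc (t ^+ m) * F t.
  have cevX f z : cev (f ^+ m) z = cev f z ^+ m by rewrite /cev rmorphXn horner_exp.
  rewrite Dp cevM cevX cev_XsubC (_ : pt t - rc r = rc t * zeta).
    by rewrite /F exprMn rmorphXn; ring.
  by rewrite /pt; ring.
by rewrite cImM /= mul0r addr0 mulrCA pmulr_rgt0.
Qed.

(** The m-th roots of u sum to 0 and none is real, so they cannot all lie in the lower
    half-plane. *)
Lemma exists_uhp_root m (u : C) : (1 < m)%N -> complex.Im u != 0 ->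
  exists2 zeta : C, 0 < complex.Im zeta & zeta ^+ m = u.
Proof.
move=> m1 Iu; have m0 : (0 < m)%N := ltnW m1.
have [s Ds] := closed_field_poly_normal ('X^m - u%:P : {poly C}).
have lc : lead_coef ('X^m - u%:P : {poly C}) = 1.
  by apply/monicP; rewrite monicXnsubC.
rewrite lc scale1r in Ds.
have rt z : z \in s -> z ^+ m = u.
  rewrite -root_prod_XsubC -Ds /root !hornerE subr_eq0 => /eqP; exact.
have ss : size s = m.
  have := size_prod_XsubC s id; rewrite /= -Ds.
  by rewrite size_XnsubC // => -[].
have sum0 : \sum_(z <- s) z = 0.
  have := @coefPn_prod_XsubC _ s; rewrite ss -lt0n => /(_ m0).
  rewrite -Ds coefB coefXn coefC.
  have -> : (m.-1 == m) = false by apply/negbTE; rewrite neq_ltn prednK // leqnn.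
  have -> : (m.-1 == 0)%N = false by apply/negbTE; rewrite -lt0n -ltnS prednK.
  by rewrite subr0 => /eqP; rewrite eq_sym oppr_eq0 => /eqP.
have [/hasP [z zs Iz]|/hasPn hn] := boolP (has (fun z => 0 < complex.Im z) s).
  by exists z => //; apply: rt.
have neg z : z \in s -> complex.Im z < 0.
  move=> zs; rewrite ltNge; apply/negP; rewrite le_eqVlt => /orP[/eqP z0|z0].
    move/negP: Iu; apply; rewrite -(rt z zs).
    have -> : z = rc (complex.Re z) by apply: complex_ext => //=.
    by rewrite -rmorphXn.
  by move: (hn z zs); rewrite z0.
have : complex.Im (\sum_(z <- s) z) < 0.
  case: (s) ss neg => [|z t] /=; first by move=> e; rewrite -e in m0.
  move=> _; rewrite big_cons; elim: t z => [|y t IH] z neg.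
    by rewrite big_nil addr0; apply: neg; rewrite mem_head.
  rewrite big_cons cImD; have h1 := neg z (mem_head _ _).
  have h2 : complex.Im (y + \sum_(j <- t) j) < 0.
    by apply: IH => v vt; apply: neg; rewrite inE vt orbT.
  by lra.
by rewrite sum0 cIm0 ltxx.
Qed.

(** At a zero of multiplicity m > 1, directions zeta with zeta^m = i and zeta^m = -i both point into
    the upper half-plane, and [cross_local] yields opposite signs for a nonzero number. *)
Lemma cross_uniq (a : seq R) (q : {poly R}) k :
  (forall z, 0 < complex.Im z -> 0 < k * cross (prodX a) q z) ->
  (forall x, x \in a -> q.[x] != 0) -> uniq a.
Proof.
move=> hk hq.
suff nd r a' : ~ perm_eq a (r :: r :: a').
  elim: a nd {hk hq} => // x a IH nd; rewrite cons_uniq; apply/andP; split.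
    by apply/negP => /perm_to_rem px; apply: (nd x (rem x a)); rewrite perm_cons.
  apply: IH => r a' pa; apply: (nd r (x :: a')); rewrite -(perm_cons x) in pa.
  apply: perm_trans pa _; rewrite -[[:: x, r, r & a']]/([:: x] ++ [:: r; r] ++ a').
  by rewrite perm_catCA.
move=> pa; have qr : q.[r] != 0 by apply: hq; rewrite (perm_mem pa) mem_head.
pose b := [seq x <- a | x != r]; pose m := count_mem r a.
have Dp : prodX a = ('X - r%:P) ^+ m * prodX b.
  rewrite /prodX (bigID (pred1 r)) /= [\prod_(x <- b) _]big_filter; congr (_ * _).
  rewrite (eq_bigr (fun=> 'X - r%:P)) => [|x /eqP -> //].
  by rewrite -big_filter big_const_seq count_predT size_filter -/m iter_mulr_1.
have m1 : (1 < m)%N by rewrite /m (permP pa) /= eqxx.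
have br : (prodX b).[r] != 0.
  by rewrite -[_ == 0]/(root _ _) root_prod_XsubC mem_filter eqxx.
have [z1 I1 e1] := @exists_uhp_root m 'i%C m1 (oner_neq0 R).
have [|z2 I2 e2] := @exists_uhp_root m (- 'i%C) m1.
  by rewrite cImN /= oppr_eq0 oner_eq0.
have := cross_local hk Dp I1; have := cross_local hk Dp I2.
rewrite e1 e2 cImN /= mul1r mulN1r mulrN oppr_ge0 => h1 h2.
have k0 : k != 0 by apply: contraTneq (hk z1 I1) => ->; rewrite mul0r ltxx.
have : k * ((prodX b).[r] * q.[r]) = 0 by apply/eqP; rewrite eq_le h1 h2.
by move/eqP; rewrite !mulf_eq0 (negbTE k0) (negbTE br) (negbTE qr).
Qed.

(** [cross_local] in the direction i at x and at y shows that A2 B changes sign on [x,y], where B =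
    [prodX b]; as A2 has no zero there, B has one. *)
Lemma cross_between (a b : seq R) k : sorted <=%R a -> uniq a ->
  (forall z, 0 < complex.Im z -> 0 < k * cross (prodX a) (prodX b) z) ->
  between b a.
Proof.
move=> sa ua hk a1 x y a2 ea.
have : pairwise <%R a.
  by rewrite -(sorted_pairwise lt_trans) lt_sorted_uniq_le ua sa.
rewrite {1}ea pairwise_cat /= => /and3P[/allrelP l1 _ /and3P[/andP[xy _] l2 _]].
set A2 := prodX (a1 ++ a2).
have A2n t : x <= t -> t <= y -> A2.[t] != 0.
  move=> xt ty; rewrite -[_ == 0]/(root _ _) root_prod_XsubC mem_cat.
  apply/negP => /orP[ta|/(allP l2)].
    by have := l1 t x ta (mem_head _ _); rewrite ltNge xt.
  by rewrite ltNge ty.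
have [/hasP [z zb xzy]|/hasPn hn] := boolP (has (fun z => (x <= z) && (z <= y)) b).
  by exists z.
have Bn t : x <= t -> t <= y -> (prodX b).[t] != 0.
  move=> xt ty; rewrite -[_ == 0]/(root _ _) root_prod_XsubC.
  by apply/negP => /hn; rewrite xt ty.
have perm_a : perm_eq a [:: x, y & a1 ++ a2].
  by rewrite ea -[x :: y :: a2]/([:: x; y] ++ a2) perm_catCA.
have Dx : prodX a = ('X - x%:P) ^+ 1 * (('X - y%:P) * A2).
  by rewrite /prodX (perm_big _ perm_a) /= !big_cons expr1.
have Dy : prodX a = ('X - y%:P) ^+ 1 * (('X - x%:P) * A2).
  by rewrite Dx !expr1 mulrCA.
have := cross_local hk Dx (ltr01 : 0 < complex.Im 'i%C).
have := cross_local hk Dy (ltr01 : 0 < complex.Im 'i%C).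
rewrite expr1 /= !mul1r !hornerM !hornerXsubC -!mulrA !(mulrCA k).
rewrite pmulr_rge0 ?subr_gt0 // => hy; rewrite nmulr_rge0 ?subr_lt0 // => hx.
have [||t] := @poly_ivt R (k *: (A2 * prodX b)) x y; first exact: ltW.
  by rewrite !hornerZ !hornerM !(mulrCA k) hx hy.
move=> /andP[xt ty]; rewrite /root hornerZ hornerM !mulf_eq0.
rewrite (negbTE (A2n t xt ty)) (negbTE (Bn t xt ty)) !orbF => /eqP k0.
by have := hk 'i%C ltr01; rewrite k0 mul0r ltxx.
Qed.

Lemma crossZ (c d : R) p q z : cross (c *: p) (d *: q) z = c * d * cross p q z.
Proof. by rewrite /cross !cevZ !reimE /=; ring. Qed.

Lemma crossM (p q : {poly R}) x z : 0 < complex.Im z ->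
  exists2 c, 0 < c & cross (('X - x%:P) * p) (('X - x%:P) * q) z = c * cross p q z.
Proof.
move=> Iz; exists ((complex.Re z - x) ^+ 2 + complex.Im z ^+ 2).
  by rewrite ltr_wpDl ?sqr_ge0 // exprn_gt0.
by rewrite /cross !cevM cev_XsubC !reimE /=; ring.
Qed.

Lemma prodX_perm (a b : seq R) : perm_eq a b -> prodX a = prodX b.
Proof. by move=> h; rewrite /prodX (perm_big _ h). Qed.

(** A common zero x contributes the positive factor |z - x|^2; it is cancelled and put back by
    [evod_insert]. Without common zeros both lists are simple and separate each other. *)
Lemma cross_evod (a b : seq R) k :
  (forall z, 0 < complex.Im z -> 0 < k * cross (prodX a) (prodX b) z) ->
  exists2 c, sorted <=%R c &
    prodX a = pev c /\ prodX b = pod c \/ prodX b = pev c /\ prodX a = pod c.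
Proof.
have [m] := ubnP (size a); elim: m a b => // m IH a b sm hk.
have [/hasP [x xa xb]|/hasPn hn] := boolP (has (mem b) a).
  have Da := prodX_perm (perm_to_rem xa); have Db := prodX_perm (perm_to_rem xb).
  rewrite !prodX_cons in Da Db.
  have [||c sc hc] := IH (rem x a) (rem x b).
  - by rewrite size_rem //; case: (a) xa sm.
  - move=> z Iz; have := hk z Iz; rewrite Da Db.
    have [d d0 ->] := crossM (prodX (rem x a)) (prodX (rem x b)) x Iz.
    by rewrite mulrCA pmulr_rgt0.
  have [c' [sc' e o]] := evod_insert x sc.
  by exists c' => //; rewrite Da Db e o; case: hc => -[-> ->]; [left|right].
have pa : perm_eq (sort <=%R a) a by rewrite perm_sort.
have pb : perm_eq (sort <=%R b) b by rewrite perm_sort.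
rewrite -(prodX_perm pa) -(prodX_perm pb) in hk *.
have dis x : x \in sort <=%R a -> x \notin sort <=%R b.
  by rewrite !mem_sort => /hn.
have hk' z : 0 < complex.Im z ->
    0 < - k * cross (prodX (sort <=%R b)) (prodX (sort <=%R a)) z.
  by move=> Iz; rewrite cross_swap mulrNN; apply: hk.
have ua : uniq (sort <=%R a).
  apply: cross_uniq hk _ => x xa.
  by rewrite -[_ == 0]/(root _ _) root_prod_XsubC; apply: dis.
have ub : uniq (sort <=%R b).
  apply: cross_uniq hk' _ => x xb.
  rewrite -[_ == 0]/(root _ _) root_prod_XsubC; apply/negP => /dis.
  by rewrite xb.
have sa := sort_le_sorted a; have sb := sort_le_sorted b.
have [c sc hc] := between_evod sa sb dis (cross_between sa ua hk) (cross_between sb ub hk').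
by exists c => //; rewrite /pev /pod; case: hc => ->; [left|right].
Qed.

Lemma evod_subseq (c : seq R) : subseq (evod c).1 c /\ subseq (evod c).2 c.
Proof.
elim: c => //= x c [h1 h2]; rewrite eqxx; split=> //.
exact: subseq_trans h1 (subseq_cons _ _).
Qed.

Lemma size_evod (c : seq R) : size (evod c).2 = size (evod c).1 \/
  (size (evod c).2).+1 = size (evod c).1.
Proof. by elim: c => [|x c [IH|IH]] /=; [left|right|left]; rewrite // IH. Qed.

Lemma cross_interlace (P Q : {poly R}) k : hyperbolic P -> hyperbolic Q ->
  (forall z, 0 < complex.Im z -> 0 < k * cross P Q z) -> zeros_interlace P Q.
Proof.
move=> hP hQ hk; have [a DP] := hyperbolic_split hP; have [b DQ] := hyperbolic_split hQ.
have [z Iz|c sc hc] := @cross_evod a b (k * (lead_coef P * lead_coef Q)).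
  by rewrite -mulrA -crossZ -DP -DQ; apply: hk.
have [s1 s2] := evod_subseq c.
have ss s : subseq s c -> sorted <=%R s by move=> h; apply: subseq_sorted h sc; apply: le_trans.
have il : interlace_seq (evod c).1 (evod c).2.
  by split; [exact: size_evod|rewrite evodK].
case: hc => -[ea eb].
  exists (evod c).1, (evod c).2; split; [|split]; last by left.
    by split; [exact: ss|rewrite {1}DP -/(prodX _) ea].
  by split; [exact: ss|rewrite {1}DQ -/(prodX _) eb].
exists (evod c).2, (evod c).1; split; [|split]; last by right.
  by split; [exact: ss|rewrite {1}DP -/(prodX _) eb].
by split; [exact: ss|rewrite {1}DQ -/(prodX _) ea].
Qed.

Lemma cross_neq0_interlace (P Q : {poly R}) : hyperbolic P -> hyperbolic Q ->
  (forall z, 0 < complex.Im z -> cross P Q z != 0) -> zeros_interlace P Q.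
Proof.
move=> hP hQ h; apply: (@cross_interlace _ _ (cross P Q 'i%C)) => // z Iz.
have I1 : 0 < complex.Im ('i%C : C) by exact: ltr01.
pose pt t := 'i%C + rc t * (z - 'i%C).
(* The sign is transported from i to z along the segment; at i the quantity is a square. *)
pose F t := rc (cross P Q 'i%C) * (cev P (pt t) * conjc (cev Q (pt t))).
have FE t : complex.Im (F t) = cross P Q 'i%C * cross P Q (pt t).
  by rewrite /F cImM /= mul0r addr0.
have p0 : pt 0 = 'i%C by rewrite /pt mul0r addr0.
have p1 : pt 1 = z by rewrite /pt mul1r subrKC.
have c0 : cross P Q 'i%C != 0 by apply: h.
have := @im_same_sign R F; rewrite !FE p0 p1; apply.
- apply: pf_mul (pf_const _) _; apply: pf_mul; first exact: pf_horner (pf_segment _ _).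
  by apply: pf_conj; exact: pf_horner (pf_segment _ _).
- by move=> t t0 t1; rewrite FE mulf_neq0 // h // segment_uhp.
- by rewrite -expr2 exprn_even_gt0.
Qed.

End Obreschkoff.

(** * Necessity *)

Section Necessity.
Variable R : realType.
Local Notation C := (complex R).
Local Notation rc := (real_complex R).
Variables (n : nat) (T : {poly R} -> {poly R}).
Hypothesis hT : linear_on n T.

Lemma size_scale_add (c : R) (p q : {poly R}) m : (size p <= m)%N ->
  (size q <= m)%N -> (size (c *: p + q)%R <= m)%N.
Proof.
move=> sp sq; rewrite (leq_trans (size_polyD _ _)) // geq_max sq andbT.
exact: leq_trans (size_scale_leq _ _) sp.
Qed.

Definition interlacing_form := exists (alpha beta : {poly R} -> R) (P Q : {poly R}),
  [/\ lin_functional_on n alpha /\ lin_functional_on n beta,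
      hyperbolic P, hyperbolic Q, zeros_interlace P Q &
      forall f : {poly R}, (size f <= n.+1)%N ->
        T f = alpha f *: P + beta f *: Q].

Lemma zeros_interlace_refl (P : {poly R}) : hyperbolic P -> zeros_interlace P P.
Proof.
move=> hP; have [s Ds] := hyperbolic_split hP.
have z : zero_list P (sort <=%R s).
  split; first exact: sort_le_sorted.
  by rewrite {1}Ds; congr (_ *: _); apply: perm_big; rewrite perm_sym perm_sort.
exists (sort <=%R s), (sort <=%R s); do 2!split=> //; left; split; first by left.
have := sort_le_sorted s; case: (sort _ _) => //= x t.
by elim: t x => [|y t IH] x /=; rewrite lexx // => /andP[-> /IH].
Qed.

Lemma hyperbolic1 : hyperbolic (1 : {poly R}).
Proof.
have := split_hyperbolic (R := R) [::] (oner_neq0 R).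
by rewrite big_nil scale1r.
Qed.

Lemma lin_functional_form (phi : {poly R} -> {poly R} -> R) (D : R) (g : {poly R}) :
  (forall c p q, phi (c *: p + q) g = c * phi p g + phi q g) ->
  lin_functional_on n (fun f => phi (T f) g / D).
Proof. by move=> h c f f' sf sf'; rewrite hT // h mulrDl mulrA. Qed.

Lemma crossDl c (p q g : {poly R}) z :
  cross (c *: p + q) g z = c * cross p g z + cross q g z.
Proof. by rewrite /cross cevD cevZ !reimE /=; ring. Qed.

(** The inner product of p(z) and g(z) as vectors of the real plane, of which [cross] is, up to
    sign, the determinant. *)
Definition dotp (p g : {poly R}) z := complex.Re (cev p z * conjc (cev g z)).

Lemma dotpDl c (p q g : {poly R}) z :
  dotp (c *: p + q) g z = c * dotp p g z + dotp q g z.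
Proof. by rewrite /dotp cevD cevZ !reimE /=; ring. Qed.

Lemma im_mul_conj_eq0 (a b : C) : complex.Im (a * conjc b) = 0 ->
  rc (complex.Re (b * conjc b)) * a = rc (complex.Re (a * conjc b)) * b.
Proof.
rewrite !reimE; case: a b => [p q] [r s] /= h; apply: complex_ext; rewrite !reimE /=.
  by rewrite !mul0r !subr0 -[RHS]addr0 -(mulr0 (- s)) -h; ring.
by rewrite !mul0r !addr0 -[RHS]addr0 -(mulr0 r) -h; ring.
Qed.

Lemma im_mul_conj_eq0_both (a b v : C) : complex.Im (a * conjc b) != 0 ->
  complex.Im (v * conjc a) = 0 -> complex.Im (v * conjc b) = 0 -> v = 0.
Proof.
rewrite !reimE; case: a b v => [p q] [r s] [x y] /= h h1 h2.
have e1 : x * (p * - s + q * r) = 0.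
  by rewrite -(mulr0 p) -{1}h2 -[LHS]addr0 -(mulr0 r) -h1; ring.
have e2 : y * (p * - s + q * r) = 0.
  by rewrite -(mulr0 q) -{1}h2 -[LHS]addr0 -(mulr0 s) -h1; ring.
by apply: complex_ext => /=; apply/eqP; [move/eqP: e1|move/eqP: e2];
  rewrite mulf_eq0 (negbTE h) orbF.
Qed.

Lemma mul_conj_neq0 (b : C) : b != 0 -> complex.Re (b * conjc b) != 0.
Proof.
apply: contra_neq; rewrite !reimE mulrN opprK -!expr2 => /eqP.
rewrite paddr_eq0 ?sqr_ge0 // !sqrf_eq0 => /andP[/eqP e1 /eqP e2].
exact: complex_ext.
Qed.

(* A linear space of hyperbolic polynomials has dimension at most 2, because
   evaluation at i is an injective real-linear map from it to C. *)
Lemma hyperbolic_range_form :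
  (forall g : {poly R}, (size g <= n.+1)%N -> hyperbolic (T g) \/ T g = 0) ->
  interlacing_form.
Proof.
move=> hall.
have comb k l (p q : {poly R}) : (size p <= n.+1)%N -> (size q <= n.+1)%N ->
    hyperbolic (k *: T p + l *: T q) \/ k *: T p + l *: T q = 0.
  move=> sp sq; have -> : k *: T p + l *: T q = T (k *: p + l *: q).
    rewrite hT //; last exact: leq_trans (size_scale_leq _ _) sq.
    by rewrite (linear_onZ hT).
  apply: hall; apply: leq_trans (size_polyD _ _) _.
  by rewrite geq_max !(leq_trans (size_scale_leq _ _)).
have comb0 k l (p q : {poly R}) z : (size p <= n.+1)%N -> (size q <= n.+1)%N ->
    complex.Im z != 0 -> rc k * cev (T p) z + rc l * cev (T q) z = 0 ->
    k *: T p + l *: T q = 0.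
  move=> sp sq Iz; rewrite -!cevZ -cevD => h.
  have [hy|//] := comb k l p q sp sq.
  by have := hyperbolic_neq0 hy Iz; rewrite -[(map_poly _ _).[z]]/(cev _ _) h eqxx.
have I1 : complex.Im ('i%C : C) != 0 by rewrite oner_neq0.
case: (pselect (exists f0 f1 : {poly R}, [/\ (size f0 <= n.+1)%N, (size f1 <= n.+1)%N &
    cross (T f0) (T f1) 'i%C != 0])) => [[f0 [f1 [s0 s1 c01]]]|h01].
  set P := T f0; set Q := T f1; rewrite -/P -/Q in c01.
  have P0 : P != 0.
    by apply: contra_neq c01 => h; rewrite /cross h /cev map_poly0 horner0 mul0r.
  have Q0 : Q != 0.
    apply: contra_neq c01 => h.
    by rewrite /cross h /cev map_poly0 horner0 conjc0 mulr0.
  have hP : hyperbolic P by case: (hall f0 s0) => // /eqP; rewrite (negbTE P0).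
  have hQ : hyperbolic Q by case: (hall f1 s1) => // /eqP; rewrite (negbTE Q0).
  (* Cramer's rule for the coordinates of (T f)(i) in the real basis P(i), Q(i). *)
  exists (fun f => cross (T f) Q 'i%C / cross P Q 'i%C).
  exists (fun f => cross (T f) P 'i%C / cross Q P 'i%C).
  exists P, Q; split=> //.
  - by split; apply: (lin_functional_form (phi := fun p g => cross p g 'i%C)) => *;
      apply: crossDl.
  (* Dependence of P(z) and Q(z) gives a combination with k nonzero that vanishes at z, hence
     identically by [comb0], hence at i. *)
  - apply: cross_neq0_interlace => // z Iz; apply: contra_neq c01 => cz.
    set k := complex.Re (cev Q z * conjc (cev Q z)).
    set l := - dotp P Q z.
    have k0 : k != 0 by apply/mul_conj_neq0/hyperbolic_neq0/lt0r_neq0.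
    have e : rc k * cev P z + rc l * cev Q z = 0.
      by rewrite /l rmorphN mulNr (im_mul_conj_eq0 cz) subrr.
    have e' := comb0 k l f0 f1 z s0 s1 (lt0r_neq0 Iz) e.
    have e2 : rc k * cev P 'i%C + rc l * cev Q 'i%C = 0.
      by rewrite -!cevZ -cevD e' /cev map_poly0 horner0.
    apply/eqP; apply: contraNT k0 => c0.
    by have [->] := real_comb_eq0 c0 e2.
  move=> f sf; apply/eqP; rewrite -subr_eq0; apply/eqP.
  set a := _ / _; set b := _ / _.
  have c10 : cross Q P 'i%C != 0 by rewrite cross_swap oppr_eq0.
  pose h := - b *: f1 + (- a *: f0 + f).
  have sm := size_scale_add (- a) s0 sf.
  have sh : (size h <= n.+1)%N by apply: size_scale_add.
  have Dh : T f - (a *: P + b *: Q) = T h.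
    by rewrite /h hT // hT // !scaleNr -/P -/Q; ring.
  rewrite Dh; have [hy|//] := hall h sh.
  have := hyperbolic_neq0 hy I1; rewrite -[(map_poly _ _).[_]]/(cev _ _).
  suff -> : cev (T h) 'i%C = 0 by rewrite eqxx.
  have x1 : cross (T h) Q 'i%C = 0.
    rewrite -Dh addrC -scaleN1r crossDl crossDl -[b *: Q]addr0 crossDl.
    have -> : cross Q Q 'i%C = 0 by rewrite /cross !reimE; ring.
    have -> : cross 0 Q 'i%C = 0 by rewrite /cross /cev map_poly0 horner0 mul0r.
    by rewrite /a; field.
  have x2 : cross (T h) P 'i%C = 0.
    rewrite -Dh addrC -scaleN1r crossDl crossDl -[b *: Q]addr0 crossDl.
    have -> : cross P P 'i%C = 0 by rewrite /cross !reimE; ring.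
    have -> : cross 0 P 'i%C = 0 by rewrite /cross /cev map_poly0 horner0 mul0r.
    by rewrite /b; field.
  exact: (im_mul_conj_eq0_both c01).
(* All values at i are now parallel: either the range is zero, or it is the line of P, with
   coordinate given by projection on P(i). *)
have cr0 (f g : {poly R}) : (size f <= n.+1)%N -> (size g <= n.+1)%N -> cross (T f) (T g) 'i%C = 0.
  by move=> sf sg; apply/eqP/negPn/negP => h; apply: h01; exists f, g.
have lin0 : lin_functional_on n (fun=> 0 : R) by move=> c f g _ _; rewrite mulr0 addr0.
case: (pselect (exists2 f0 : {poly R}, (size f0 <= n.+1)%N & T f0 != 0));
  last first; first move=> h0.
  exists (fun=> 0), (fun=> 0), 1, 1; split=> //; try exact: hyperbolic1.
    exact/zeros_interlace_refl/hyperbolic1.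
  move=> f sf; rewrite !scale0r addr0; apply/eqP/negPn/negP => h.
  by apply: h0; exists f.
move=> [f0 s0 P0]; set P := T f0 in P0.
have hP : hyperbolic P by case: (hall f0 s0) => // /eqP; rewrite (negbTE P0).
have PI : cev P 'i%C != 0 by apply: hyperbolic_neq0.
exists (fun f => dotp (T f) P 'i%C / dotp P P 'i%C), (fun=> 0), P, P; split=> //.
- split=> //; apply: (lin_functional_form (phi := fun p g => dotp p g 'i%C)) => *.
  exact: dotpDl.
- exact: zeros_interlace_refl.
move=> f sf; rewrite scale0r addr0; set a := _ / _.
apply/eqP; rewrite -subr_eq0 -scaleNr -[T f]scale1r; apply/eqP.
apply: (comb0 _ _ _ _ 'i%C) => //.
have d0 := mul_conj_neq0 PI; have := im_mul_conj_eq0 (cr0 f f0 sf s0).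
rewrite rmorph1 mul1r /a rmorphN fmorph_div mulNr /dotp -/P => h.
have d0' : rc (complex.Re (cev P 'i%C * conjc (cev P 'i%C))) != 0.
  by rewrite fmorph_eq0.
by apply: (mulfI d0'); rewrite mulrBr h; field.
Qed.

Definition symbol_at z w := (cxT n T (('X + w%:P) ^+ n)).[z].

Lemma cev_half_power c w z :
  cev (T (half_power_re n c w)) z =
  c * symbol_at z w + conjc c * symbol_at z (conjc w).
Proof.
rewrite /cev -(cxT_map hT) ?half_power_re_size // half_power_reE.
by rewrite linearD !linearZ /= hornerD !hornerZ.
Qed.

(** c = conj(a) - b works unless it is 0; then b = conj(a), and i conj(a) works, or 1 if a = 0. *)
Lemma norm_eq_cancel (a b : C) : complex.Re (a * conjc a - b * conjc b) = 0 ->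
  exists2 c, c != 0 & c * a + conjc c * b = 0.
Proof.
move=> h; have e : a * conjc a = b * conjc b.
  apply: complex_ext; move: h; rewrite !reimE; last by move=> _; ring.
  by move/eqP; rewrite subr_eq0 => /eqP.
have [c0|c0] := eqVneq (conjc a) b; last first.
  exists (conjc a - b); first by rewrite subr_eq0.
  by rewrite rmorphB /= conjcK mulrBl [conjc a * a]mulrC e; ring.
have [a0|a0] := eqVneq a 0.
  by exists 1; rewrite ?oner_neq0 // -c0 a0 conjc0 !mulr0 addr0.
exists ('i%C * conjc a).
  by rewrite mulf_neq0 ?conjc_eq0 // eq_complex /= oner_eq0 andbF.
by rewrite -c0; apply: complex_ext; rewrite !reimE /=; ring.
Qed.

(** Serves the case n = 0, where 2 Re (c (x+w)^n) is a constant and may vanish. *)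
Lemma hyperbolic_const_map (g : {poly R}) : preserves_hyperbolicity n T ->
  (size g <= 1)%N -> hyperbolic (T g) \/ T g = 0.
Proof.
move=> hpres sg; have [->|g0] := eqVneq g 0; first by right; apply: linear_on0 hT.
apply: hpres; first exact: leq_trans sg _.
have -> : g = g`_0 *: 1 by rewrite {1}(size1_polyC sg) -mul_polyC mulr1.
apply: hyperbolicZ hyperbolic1.
by apply: contra_neq g0 => h; rewrite (size1_polyC sg) h.
Qed.

Lemma degenerate_symbol_form z w : preserves_hyperbolicity n T ->
  0 < complex.Im z -> 0 < complex.Im w ->
  complex.Re (symbol_at z w * conjc (symbol_at z w) -
    symbol_at z (conjc w) * conjc (symbol_at z (conjc w))) = 0 ->
  interlacing_form.
Proof.
move=> hpres Iz Iw /norm_eq_cancel [c c0 hc]; apply: hyperbolic_range_form => g sg.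
case: (posnP n) => n0; first by apply: hyperbolic_const_map; rewrite // -n0.
have hf := half_power_re_hyperbolic c0 Iw n0.
have sf := half_power_re_size n c w.
have Tf0 : T (half_power_re n c w) = 0.
  have [hy|//] := hpres _ sf hf.
  have := hyperbolic_neq0 hy (lt0r_neq0 Iz).
  by rewrite -[(map_poly _ _).[z]]/(cev _ _) cev_half_power hc eqxx.
have [e e0 he] := simple_perturb hf (half_power_re_simple c0 Iw n0)
  (half_power_re_size_ge n c0 Iw) sf sg.
have Te : T (half_power_re n c w + e *: g) = e *: T g.
  by rewrite addrC hT // Tf0 addr0.
have ss : (size (half_power_re n c w + e *: g)%R <= n.+1)%N.
  by rewrite addrC size_scale_add.
have -> : T g = e^-1 *: T (half_power_re n c w + e *: g).
  by rewrite Te scalerA mulVf // scale1r.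
case: he => [hy|->]; last by right; rewrite (linear_on0 hT) scaler0.
have [hy'|->] := hpres _ ss hy; last by right; rewrite scaler0.
by left; apply: hyperbolicZ => //; rewrite invr_eq0.
Qed.

Lemma pf_symbol_at Z W : polyfun Z -> polyfun W ->
  polyfun (fun t => symbol_at (Z t) (W t)).
Proof.
move=> pZ pW.
have [G hG] : polyfun (fun t => \sum_(i < n.+1)
    (W t ^+ (n - i) * ('C(n, i))%:R) * (map_poly rc (T 'X^i)).[Z t]).
  apply: pf_sum => i; apply: pf_mul; last exact: pf_horner.
  by apply: pf_mul (pf_const _); apply: pf_exp.
exists G => t; rewrite -hG /symbol_at /cxT horner_sum; apply: eq_bigr => i _.
by rewrite hornerZ coef_XaddC_exp ?mulr_natr // -ltnS.
Qed.

Lemma nondegenerate_symbol_sign :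
  (forall z w, 0 < complex.Im z -> 0 < complex.Im w ->
    complex.Re (symbol_at z w * conjc (symbol_at z w) -
      symbol_at z (conjc w) * conjc (symbol_at z (conjc w))) != 0) ->
  (forall z w, 0 < complex.Im z -> 0 < complex.Im w -> symbol_at z w != 0) \/
  (forall z w, 0 < complex.Im z -> 0 < complex.Im w -> symbol_at z (conjc w) != 0).
Proof.
set J := fun z w => complex.Re (symbol_at z w * conjc (symbol_at z w) -
      symbol_at z (conjc w) * conjc (symbol_at z (conjc w))).
move=> hJ; have I1 : 0 < complex.Im ('i%C : C) by exact: ltr01.
have sgn z w : 0 < complex.Im z -> 0 < complex.Im w -> 0 < J 'i%C 'i%C * J z w.
  move=> Iz Iw.
  pose Z t := 'i%C + rc t * (z - 'i%C); pose W t := 'i%C + rc t * (w - 'i%C).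
  have pZ : polyfun Z := pf_segment _ _; have pW : polyfun W := pf_segment _ _.
  (* The factor i moves the real quantity into the imaginary part, where [im_same_sign] applies. *)
  pose F t := 'i%C * rc (J 'i%C 'i%C) *
    (symbol_at (Z t) (W t) * conjc (symbol_at (Z t) (W t)) -
      symbol_at (Z t) (conjc (W t)) * conjc (symbol_at (Z t) (conjc (W t)))).
  have FE t : complex.Im (F t) = J 'i%C 'i%C * J (Z t) (W t).
    by rewrite /F cImM cReM cImM /= !mul0r !mulr0 mul1r subrr add0r mul0r add0r.
  have Z0 : Z 0 = 'i%C by rewrite /Z mul0r addr0.
  have W0 : W 0 = 'i%C by rewrite /W mul0r addr0.
  have Z1 : Z 1 = z by rewrite /Z mul1r subrKC.
  have W1 : W 1 = w by rewrite /W mul1r subrKC.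
  have := @im_same_sign R F; rewrite !FE Z0 W0 Z1 W1; apply.
  - apply: pf_mul (pf_const _) _; apply: pf_add; last apply: pf_opp;
      apply: pf_mul; try apply: pf_conj; apply: pf_symbol_at => //; exact: pf_conj.
  - by move=> t t0 t1; rewrite FE mulf_neq0 // hJ // segment_uhp.
  - by rewrite -expr2 exprn_even_gt0 //= hJ.
have nn (v : C) : 0 <= complex.Re (v * conjc v).
  by rewrite !reimE mulrN opprK -!expr2 addr_ge0 ?sqr_ge0.
have := hJ _ _ I1 I1; rewrite -/(J _ _); case: (ltgtP (J 'i%C 'i%C) 0) => // J0 _.
  (* J < 0 means |S(z, conj w)| > |S(z,w)| >= 0, so the value at conj w is nonzero; J > 0 is
     symmetric. *)
  right=> z w Iz Iw; apply/negP => /eqP h.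
  have := sgn z w Iz Iw; rewrite nmulr_rgt0 // /J h mul0r subr0.
  by rewrite ltNge nn.
left=> z w Iz Iw; apply/negP => /eqP h.
have := sgn z w Iz Iw; rewrite pmulr_rgt0 // /J h mul0r sub0r cReN oppr_gt0.
by rewrite ltNge nn.
Qed.

Lemma eval2_0 z w : eval2 (0 : {poly {poly R}}) z w = 0.
Proof. by rewrite /eval2 map_poly0 horner0. Qed.

Lemma real_stable2_intro (p : {poly {poly R}}) :
  (forall z w, 0 < complex.Im z -> 0 < complex.Im w -> eval2 p z w != 0) ->
  real_stable2 p.
Proof.
move=> h; split=> //; apply/eqP => p0.
by have := h 'i%C 'i%C ltr01 ltr01; rewrite p0 eval2_0 eqxx.
Qed.

End Necessity.

Theorem mainTheorem1 (R : realType) (n : nat) (T : {poly R} -> {poly R})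
  (hT : linear_on n T) :
  preserves_hyperbolicity n T <->
  [\/ (exists (alpha beta : {poly R} -> R) (P Q : {poly R}),
         [/\ lin_functional_on n alpha /\ lin_functional_on n beta,
             hyperbolic P, hyperbolic Q, zeros_interlace P Q &
             forall f : {poly R}, (size f <= n.+1)%N ->
               T f = alpha f *: P + beta f *: Q]),
      real_stable2 (extT T (('X%:P + 'X) ^+ n))
    | real_stable2 (extT T (('X%:P - 'X) ^+ n))].
Proof.
split=> [hpres|[[al [be [P [Q [_ _ _ PQ hTf]]]]]|h|h]].
- case: (pselect (exists z w, [/\ 0 < complex.Im z, 0 < complex.Im w &
      complex.Re (symbol_at n T z w * conjc (symbol_at n T z w) -
      symbol_at n T z (conjc w) * conjc (symbol_at n T z (conjc w))) = 0])).
    by move=> [z [w [Iz Iw h]]]; apply: Or31; apply: (degenerate_symbol_form hT hpres Iz Iw h).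
  move=> hn; have [z w Iz Iw|h|h] := @nondegenerate_symbol_sign R n T.
  - by apply/eqP => h; apply: hn; exists z, w.
  - apply: Or32; apply: real_stable2_intro => z w Iz Iw.
    by rewrite eval2_symbol // h.
  - apply: Or33; apply: real_stable2_intro => z w Iz Iw.
    rewrite eval2_symbolN // -[_.[z]]/(symbol_at n T z (- w)).
    (* The point -conj(w) is again in the upper half-plane, and its conjugate is -w. *)
    have := h z (- conjc w) Iz; rewrite rmorphN /= conjcK cImN cImJ opprK.
    exact.
- by move=> f sf _; rewrite hTf //; apply: interlace_comb_hyperbolic.
- exact: stable_symbol_preserves.
- exact: stable_symbolN_preserves.
Qed.
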